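(* Let $n\ge2$, $M>1/(n-1)$, $J=\{1,\ldots,n\}$, $X=\{c,a_1,\ldots,a_n\}$, and let $u^0$ be the payoffs $u^0_j(c)=0$, $u^0_j(a_i)=1$ if $j=i$ and $-M$ if $j\ne i$. Put $\lambda_c=\frac{n}{(n-1)(1+M)}$, and fix $\lambda\in(\lambda_c,1)$ and $0<\delta<1$. Set $$b=\frac{\lambda}{\lambda_c}-1>0,\qquad d_0=\frac{(n-1)M-1}{n}>0.$$ Let $u^\rho$ be any payoff array on $J\times X$ satisfying $$\max_{j,x}|u_j^\rho(x)-u_j^0(x)|\le\rho,\qquad0<\rho<\min\{d_0/2,1/2\}.$$ Fix a stationary pure-strategy MPE or a stationary randomized MPE of the game with payoffs $u^\rho$, and start at $\alpha_0=(1/n,\ldots,1/n)$. Define $\tau=\inf\{t\ge1:x_t\ne c\}$, with $\inf\varnothing=\infty$ (in the pure-strategy case probabilities are those of the deterministic path). (1) For every integer $T\ge1$, $\displaystyle\mathbb P(\tau\le T)\le\min\Big\{1,\frac{2\rho}{(1-\delta)b\,\delta^{T-1}}\Big\}.$ (2) Along every pure-strategy equilibrium path, and simultaneously at all dates almost surely under randomization, $x_t=c$ implies $$\max_i\alpha_t^i\le\frac{M+2\rho}{1+M},\qquad\operatorname{dist}_1(\alpha_t,\mathcal P)\ge\frac{2(1-2\rho)}{1+M}>0.$$ (3) If the perturbed payoffs satisfy $|\arg\max_{j\in J}u^\rho_j(x)|=1$ for every action $x$ implementable under $u^\rho$, then each pure-strategy equilibrium path converges to a pure worldview and has $\tau<\infty$;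 the same assertions hold almost surely under stationary randomization. (4) For a fixed integer $T\ge1$ and $0<\eta<1$, put $$\rho_{T,\eta}=\min\Big\{\frac{d_0}2,\frac12,\frac{\eta(1-\delta)b\,\delta^{T-1}}2\Big\}>0.$$ Whenever $0<\rho<\rho_{T,\eta}$, every equilibrium specified above satisfies $\mathbb P(x_1=\cdots=x_T=c)=\mathbb P(\tau>T)>1-\eta$. The tolerance $\rho_{T,\eta}$ is uniform over the perturbed payoff arrays and the equilibria satisfying these hypotheses.
   Context: For a payoff array $u$ on finite $J\times X$: $\Delta^n=\{\alpha\in\mathbb R^n:\alpha^j\ge0,\ \sum_j\alpha^j=1\}$; $\alpha(j)$ is the vertex with weight one on $j$; $\mathcal P=\{\alpha(1),\ldots,\alpha(n)\}$ (pure worldviews); $\operatorname{dist}_1$ is $\ell^1$ distance. $U(\alpha,x)=\sum_j\alpha^ju_j(x)$, $z^*(\alpha)=\arg\max_{x\in X}U(\alpha,x)$; the implementable actions are $X^I=\bigcup_{\alpha\in\Delta^n}z^*(\alpha)$. Pure strategies: a stationary pure strategy is a pair of arbitrary maps $\phi:\Delta^n\to\Delta^n$, $z:\Delta^n\to X$ (no continuity or measurability assumed). With $\phi^k$ the $k$-fold iterate, $$C_{\phi,z}(\beta;\alpha)=\sum_{k=0}^\infty\delta^k\big[(1-\lambda)U(\phi^k(\beta),z(\phi^k(\beta)))+\lambda U(\alpha,z(\phi^k(\beta)))\big].$$ A stationary pure-strategy MPE is a pair $(\phi,z)$ such that for every $\alpha$: $z(\alpha)\in z^*(\alpha)$, and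 $C_{\phi,z}(\phi(\alpha);\alpha)\ge C_{\phi,z}(\beta;\alpha)$ for every $\beta\in\Delta^n$. The path from $\alpha_0$ is $\alpha_{t+1}=\phi(\alpha_t)$, $x_t=z(\alpha_t)$. Randomized strategies: a stationary randomized strategy is a Borel probability kernel $\alpha\mapsto\Pi_\alpha$ from $\Delta^n$ to $X\times\Delta^n$, with marginals $s_\alpha$ on $X$ and $\kappa_\alpha$ on $\Delta^n$. From a fixed $\alpha_0$, conditional on the history $(\alpha_0,x_0,\ldots,x_{t-1},\alpha_t)$, the pair $(x_t,\alpha_{t+1})$ has law $\Pi_{\alpha_t}$; $\mathbb E_\beta$ is expectation when $\alpha_0=\beta$. Put $$C_\Pi(\beta;\alpha)=\mathbb E_\beta\sum_{k=0}^\infty\delta^k\big[(1-\lambda)U(\alpha_k,x_k)+\lambda U(\alpha,x_k)\big],\qquad S(\alpha)=\int C_\Pi(\beta;\alpha)\,\kappa_\alpha(d\beta).$$ $\Pi$ is a stationary randomized MPE if for every $\alpha$: $s_\alpha(z^*(\alpha))=1$ and $S(\alpha)\ge C_\Pi(\gamma;\alpha)$ for every $\gamma\in\Delta^n$. *)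

(* Defs.v *)
From HB Require Import structures.
From mathcomp Require Import all_boot all_order all_algebra.
From mathcomp Require Import all_classical all_reals all_analysis.

Set Implicit Arguments.
Unset Strict Implicit.
Unset Printing Implicit Defensive.
Set Warnings "-redundant-canonical-projection,-projection-no-head-constant".

Import Order.TTheory GRing.Theory Num.Theory.
Import numFieldNormedType.Exports.

Local Open Scope classical_set_scope.
Local Open Scope ring_scope.

(* The library's measurable types are pointed, so the number of states is
   n = m.+1: the simplex with m.+1 vertices is never empty. *)

(* X = {c, a_1, ..., a_n}, with c = None and a_i = Some i *)
Definition action (m : nat) : Type := option 'I_m.+1.

HB.instance Definition _ m := Finite.on (action m).
HB.instance Definition _ m := Pointed.on (action m).
HB.instance Definition _ m :=
  @isMeasurable.Build default_measure_display (action m)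
    discrete_measurable discrete_measurable0
    discrete_measurableC discrete_measurableU.

Definition act_c {m} : action m := None.

Definition in_simplex (R : realType) (m : nat) (v : 'rV[R]_m.+1) : bool :=
  [forall j, 0 <= v ord0 j] && (\sum_j v ord0 j == 1).

Record simplex (R : realType) (m : nat) := Simplex {
  coords : 'rV[R]_m.+1;
  simplexP : in_simplex coords }.

HB.instance Definition _ R m := [isSub for @coords R m].
HB.instance Definition _ R m := [Choice of simplex R m by <:].

Definition weight {R : realType} {m} (a : simplex R m) (j : 'I_m.+1) : R :=
  coords a ord0 j.
Coercion weight : simplex >-> Funclass.

Lemma vertex_subproof (R : realType) m (j : 'I_m.+1) :
  in_simplex (delta_mx ord0 j : 'rV[R]_m.+1).
Proof.
apply/andP; split; first by apply/forallP => i; rewrite mxE ler0n.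
apply/eqP; rewrite (bigD1 j)//= mxE !eqxx big1 ?addr0// => i ij.
by rewrite mxE (negbTE ij) andbF.
Qed.

Definition vertex (R : realType) m (j : 'I_m.+1) : simplex R m :=
  Simplex (vertex_subproof R j).

Lemma barycenter_subproof (R : realType) m :
  in_simplex (const_mx (1 / m.+1%:R) : 'rV[R]_m.+1).
Proof.
apply/andP; split; first by apply/forallP => i; rewrite mxE divr_ge0.
under eq_bigr do rewrite mxE.
by rewrite sumr_const card_ord -[_ *+ _]mulr_natr mul1r mulVf ?pnatr_eq0.
Qed.

Definition barycenter (R : realType) m : simplex R m :=
  Simplex (barycenter_subproof R m).

HB.instance Definition _ R m :=
  isPointed.Build (simplex R m) (barycenter R m).

(* Borel sigma-algebra: generated by the relatively open subsets. *)
Definition simplex_open (R : realType) m : set (set (simplex R m)) :=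
  [set @coords R m @^-1` O | O in @open 'rV[R]_m.+1].

HB.instance Definition _ R m :=
  @isMeasurable.Build default_measure_display (simplex R m)
    <<s @simplex_open R m >> (@sigma_algebra0 _ setT (@simplex_open R m))
    (@sigma_algebraC _ (@simplex_open R m))
    (@sigma_algebra_bigcup _ setT (@simplex_open R m)).

Definition pure_worldviews (R : realType) m : set (simplex R m) :=
  range (@vertex R m).

Definition dist1 (R : realType) m (a b : simplex R m) : R :=
  \sum_j `|a j - b j|.

Definition dist1_set (R : realType) m (a : simplex R m)
    (S : set (simplex R m)) : R :=
  inf [set dist1 a p | p in S].

Definition argmax (R : realType) (T : finType) (f : T -> R) : {set T} :=
  [set x | [forall y, f y <= f x]].

Section Game.
Context {R : realType} {m : nat}.
Implicit Types (u : 'I_m.+1 -> action m -> R) (lam delta : R).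

Definition payoff u (a : simplex R m) (x : action m) : R :=
  \sum_j a j * u j x.

Definition zstar u (a : simplex R m) : {set action m} := argmax (payoff u a).

Definition implementable u : set (action m) :=
  \bigcup_(a in [set: simplex R m]) [set` zstar u a].

Definition discounted u lam delta (a : simplex R m)
    (as_ : nat -> simplex R m) (xs : nat -> action m) : R :=
  limn (series (fun k => delta ^+ k *
    ((1 - lam) * payoff u (as_ k) (xs k) + lam * payoff u a (xs k)))).

Definition pure_value u lam delta (phi : simplex R m -> simplex R m)
    (z : simplex R m -> action m) (b a : simplex R m) : R :=
  discounted u lam delta a
    (fun k => iter k phi b) (fun k => z (iter k phi b)).

Definition pure_MPE u lam delta (phi : simplex R m -> simplex R m)
    (z : simplex R m -> action m) : Prop :=
  forall a, z a \in zstar u a /\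
    forall b, pure_value u lam delta phi z b a <=
              pure_value u lam delta phi z (phi a) a.

Section Process.
Context {d : measure_display} {Omega : measurableType d}.
Implicit Types (P : probability Omega R) (A : nat -> Omega -> simplex R m)
  (X : nat -> Omega -> action m).

(* Events generating the sigma-algebra of the history
   (alpha_0, x_0, ..., x_{t-1}, alpha_t). *)
Definition history_events A X (t : nat) : set (set Omega) :=
  [set E | (exists s B, [/\ (s <= t)%N, measurable B & E = A s @^-1` B]) \/
           (exists s B, [/\ (s < t)%N, measurable B & E = X s @^-1` B])].

(* Under P the process starts at b and, conditionally on the history up to
   alpha_t, the pair (x_t, alpha_{t+1}) has law Pi_{alpha_t}: Pi_{alpha_t}(B)
   is a version of the conditional probability of the event
   (x_t, alpha_{t+1}) \in B. *)
Definition path_process (Pi : R.-pker simplex R m ~> (action m * simplex R m)%type)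
    (b : simplex R m) P A X : Prop :=
  [/\ forall t, measurable_fun setT (A t),
      forall t, measurable_fun setT (X t),
      P [set w | A 0 w = b] = 1%E &
      forall t (H : set Omega) (B : set (action m * simplex R m)%type),
        <<s history_events A X t >> H -> measurable B ->
        P (H `&` [set w | B (X t w, A t.+1 w)]) =
        (\int[P]_(w in H) Pi (A t w) B)%E].

Definition random_value u lam delta P A X (a : simplex R m) : \bar R :=
  ('E_P[fun w => discounted u lam delta a (A ^~ w) (X ^~ w)])%E.

End Process.

(* For each b the law of the path started at b is determined by Pi, and it
   exists by the Ionescu-Tulcea theorem, which the library lacks: E_b is taken
   on a realization of the process, and the values C b a do not depend on which
   one. *)
Definition randomized_MPE u lam delta
    (Pi : R.-pker simplex R m ~> (action m * simplex R m)%type) : Prop :=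
  exists (d : measure_display) (Omega : measurableType d)
    (P : simplex R m -> probability Omega R)
    (A : nat -> Omega -> simplex R m) (X : nat -> Omega -> action m),
    (forall b, path_process Pi b (P b) A X) /\
    let C b a := random_value u lam delta (P b) A X a in
    forall a,
      pushforward (Pi a) fst [set` zstar u a] = 1%E /\
      forall g, (C g a <= \int[pushforward (Pi a) snd]_b C b a)%E.

End Game.

Definition tau {R : realType} {m} (xs : nat -> action m) : \bar R :=
  ereal_inf [set t%:R%:E | t in [set t | (1 <= t)%N /\ xs t <> act_c]].

(* Law of the deterministic path xs: the point mass at xs. *)
Definition path_prob {R : realType} {m} (xs : nat -> action m)
    (E : set (nat -> action m)) : \bar R :=
  (\1_E xs)%:E.

Definition base_payoff (R : realType) m (M : R)
    (j : 'I_m.+1) (x : action m) : R :=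
  if x is Some i then if j == i then 1 else - M else 0.

(* The default 0 is harmless: all entries are nonnegative. *)
Definition payoff_dist (R : realType) m (u v : 'I_m.+1 -> action m -> R) : R :=
  \big[Order.max/0]_j \big[Order.max/0]_x `|u j x - v j x|.

Definition max_weight (R : realType) m (a : simplex R m) : R :=
  \big[Order.max/0]_j a j.

Definition lambda_c (R : realType) (n : nat) (M : R) : R :=
  n%:R / ((n%:R - 1) * (1 + M)).

Definition b_param (R : realType) (n : nat) (M lam : R) : R :=
  lam / lambda_c n M - 1.

Definition d0_param (R : realType) (n : nat) (M : R) : R :=
  ((n%:R - 1) * M - 1) / n%:R.

Definition rho_bound (R : realType) (n : nat) (M lam delta : R)
    (T : nat) (eta : R) : R :=
  Order.min (d0_param n M / 2) (Order.min (1 / 2)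
    (eta * (1 - delta) * b_param n M lam * delta ^+ T.-1 / 2)).

(* Main.v *)
(* Let F a be the equilibrium value at worldview a, H b a the value at a of the
   plan followed from b on, and best a = max_x U(a, x). H b is affine and
   supports F at b: H b <= F and H b b = F b. Since staying at a is a possible
   deviation, best <= (1 - delta) F.

   Exit: at the barycenter a date with action c yields at most rho and any
   other date at most rho - b, while the total is at least
   - rho / (1 - delta). So the discounted frequency of exit is at most
   2 rho / ((1 - delta) b).

   Convergence: optimality of the step from a_t to a_(t+1) gives
   (1 - delta) F a_t <= (1 - lam) best a_(t+1) + lam best a_t, so best is
   nondecreasing along the path and the slack (1 - delta) F a_t - best a_t
   tends to 0. A worldview with zero slack is a vertex: otherwise a small
   move towards the model favoured by the current action raises best to first
   order, while the support H changes only to second order. By compactness the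
   path approaches the vertices, and near the vertex i a small slack forces the
   next action to be a_i, so that the path cannot jump to another vertex. *)

Require Import Defs.
From HB Require Import structures.
From mathcomp Require Import all_boot all_order all_algebra.
From mathcomp Require Import all_classical all_reals all_analysis.
From mathcomp Require Import measurable_realfun.
From mathcomp Require Import ring lra.

Set Implicit Arguments.
Unset Strict Implicit.
Unset Printing Implicit Defensive.

Import Order.TTheory GRing.Theory Num.Theory.
Import numFieldNormedType.Exports.

Local Open Scope classical_set_scope.
Local Open Scope ring_scope.

(** * Discounted sums *)

(** Strategies may be discontinuous, so no limit can be taken in the policy itself. All regularity
    comes from the value: it is a maximum of affine functions of the worldview with uniformly
    bounded slopes, hence Lipschitz. Both kinds of equilibrium enter the convergence argument
    through the record [value_system], a mixed action and a supporting plan at each worldview, so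
    that argument is carried out once. Randomization raises two further difficulties. The
    equilibrium condition only bounds an average over the next worldview, so a step is optimal for
    almost every draw and not for all; a nonnegative gap with zero conditional mean vanishes at all
    dates outside one null set, and then the argument for a single path applies. Moreover the
    equilibrium values live on one realization of the process while the conclusions concern any
    realization; the values are therefore rebuilt from the kernel as iterated integrals. *)

Section DiscountedSum.
Context {R : realType} (delta : R).
Hypotheses (delta_ge0 : 0 <= delta) (delta_lt1 : delta < 1).
Implicit Types (y z : nat -> R) (B c : R).

(** Convertible to [discounted] along a fixed path. The limit of a divergent sequence is a default
    value, hence the bounds on the terms carried by the rules below. *)
Definition dsum y : R := limn (series (fun k => delta ^+ k * y k)).

Lemma dsum_cvg B y : (forall k, `|y k| <= B) ->
  cvgn (series (fun k => delta ^+ k * y k)).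
Proof.
move=> yB; apply: normed_cvg.
apply: (@series_le_cvg _ _ (geometric B delta)) => [n|n|n|].
- exact: normr_ge0.
- by apply: geometric_ge0 => //; exact: le_trans (yB 0%N).
- rewrite /= normrM ger0_norm ?exprn_ge0// mulrC.
  by rewrite ler_wpM2r ?exprn_ge0.
- by apply: is_cvg_geometric_series; rewrite ger0_norm.
Qed.

Lemma dsum_cst c : dsum (fun=> c) = c / (1 - delta).
Proof.
rewrite /dsum; apply/cvg_lim => //.
under eq_fun do rewrite mulrC.
by apply: cvg_geometric_series; rewrite ger0_norm.
Qed.

Lemma dsumD By Bz y z : (forall k, `|y k| <= By) -> (forall k, `|z k| <= Bz) ->
  dsum (fun k => y k + z k) = dsum y + dsum z.
Proof.
move=> yB zB; rewrite /dsum -lim_seriesD; [|exact: dsum_cvg yB|exact: dsum_cvg zB].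
by congr (limn (series _)); apply/funext => k /=; rewrite mulrDr.
Qed.

Lemma dsumZ B y c : (forall k, `|y k| <= B) ->
  dsum (fun k => c * y k) = c * dsum y.
Proof.
move=> yB; rewrite /dsum -[RHS](lim_seriesZ c (dsum_cvg yB)).
by congr (limn (series _)); apply/funext => k /=; rewrite mulrCA.
Qed.

Lemma dsum_sum (I : finType) B (y : I -> nat -> R) :
  (forall i k, `|y i k| <= B) ->
  dsum (fun k => \sum_i y i k) = \sum_i dsum (y i).
Proof.
move=> yB.
(* The bound on the partial sum travels with the induction, since [dsumD] asks for one at each
   step. *)
suff: forall s : seq I, (exists B', forall k, `|\sum_(i <- s) y i k| <= B') /\
    dsum (fun k => \sum_(i <- s) y i k) = \sum_(i <- s) dsum (y i).
  by move=> /(_ (index_enum I))[].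
elim=> [|i s [[B' IHB] IH]].
  split; first by exists 0 => k; rewrite big_nil normr0.
  by under eq_fun do rewrite big_nil; rewrite dsum_cst mul0r big_nil.
split.
  exists (B + B') => k; rewrite big_cons.
  by rewrite (le_trans (ler_normD _ _))// lerD.
by under eq_fun do rewrite big_cons; rewrite (dsumD (yB i) IHB) IH big_cons.
Qed.

Lemma ler_dsum By Bz y z : (forall k, `|y k| <= By) -> (forall k, `|z k| <= Bz) ->
  (forall k, y k <= z k) -> dsum y <= dsum z.
Proof.
move=> yB zB yz; apply: lim_series_le; [exact: dsum_cvg yB|exact: dsum_cvg zB|].
by move=> k; rewrite ler_wpM2l ?exprn_ge0.
Qed.

Lemma dsum_ge0 B y : (forall k, `|y k| <= B) -> (forall k, 0 <= y k) ->
  0 <= dsum y.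
Proof.
move=> yB y0; rewrite -(mul0r (1 - delta)^-1) -dsum_cst.
by apply: (@ler_dsum 0 B) => // k; rewrite normr0.
Qed.

Lemma dsum_bound B y : (forall k, `|y k| <= B) -> `|dsum y| <= B / (1 - delta).
Proof.
move=> yB; rewrite ler_norml -mulNr -!dsum_cst.
have cB c : forall k : nat, `|(fun=> c) k| <= `|c| by [].
apply/andP; split.
  by apply: (ler_dsum (cB _) yB) => k; have := yB k; rewrite ler_norml => /andP[].
by apply: (ler_dsum yB (cB _)) => k; have := yB k; rewrite ler_norml => /andP[].
Qed.

Lemma dsum_recl B y : (forall k, `|y k| <= B) ->
  dsum y = y 0%N + delta * dsum (fun k => y k.+1).
Proof.
move=> yB; have yB' k : `|y k.+1| <= B by [].
rewrite {1}/dsum; apply/cvg_lim => //; rewrite -cvg_shiftS.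
rewrite (_ : [sequence _]_n = (fun n => y 0%N + delta *
   series (fun k => delta ^+ k * y k.+1) n)); last first.
  apply/funext => n; rewrite /series/= big_nat_recl// expr0 mul1r; congr (_ + _).
  by rewrite mulr_sumr; apply: eq_bigr => i _; rewrite exprS mulrA.
apply: cvgD; first exact: cvg_cst.
by apply: cvgMr; exact: dsum_cvg yB'.
Qed.

(** Applied to the indicator of an exit: a single exit at date [T] contributes at least [delta ^+ T]
    to the discounted frequency. *)
Lemma dsum_ge_term B y T : (forall k, `|y k| <= B) -> (forall k, 0 <= y k) ->
  delta ^+ T * y T <= dsum y.
Proof.
elim: T y => [|T IH] y yB y0; rewrite (dsum_recl yB).
  rewrite expr0 mul1r lerDl mulr_ge0//.
  by apply: (@dsum_ge0 B).
rewrite exprS -mulrA (@le_trans _ _ (delta * dsum (fun k => y k.+1)))//.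
  by rewrite ler_wpM2l// (IH (fun k => y k.+1)).
by rewrite lerDr.
Qed.

End DiscountedSum.

(** * Worldviews and payoffs *)

Section Simplex.
Context {R : realType} {m : nat}.
Implicit Types (a b : simplex R m) (j : 'I_m.+1).

Lemma weight_ge0 a j : 0 <= a j.
Proof. by have /andP[/forallP/(_ j)] := simplexP a. Qed.

Lemma sum_weight a : \sum_j a j = 1.
Proof. by have /andP[_ /eqP] := simplexP a. Qed.

Lemma weight_le1 a j : a j <= 1.
Proof.
by rewrite -(sum_weight a) (bigD1 j)//= lerDl sumr_ge0// => i _; exact: weight_ge0.
Qed.

Lemma sum_weight_cst a (c : R) : \sum_j a j * c = c.
Proof. by rewrite -mulr_suml sum_weight mul1r. Qed.

Lemma simplex_eqP a b : (forall j, a j = b j) -> a = b.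
Proof.
by move=> ab; apply: val_inj; apply/rowP => j; exact: ab.
Qed.

Lemma vertexE i j : vertex R i j = (j == i)%:R.
Proof. by rewrite /weight mxE eqxx. Qed.

Lemma dist1_ge0 a b : 0 <= dist1 a b.
Proof. by apply: sumr_ge0. Qed.

Lemma dist1C a b : dist1 a b = dist1 b a.
Proof. by apply: eq_bigr => j _; exact: distrC. Qed.

Lemma dist1_le2 a b : dist1 a b <= 2.
Proof.
rewrite (_ : 2 = \sum_j a j + \sum_j b j); last by rewrite !sum_weight -mulr2n.
rewrite -big_split/=; apply: ler_sum => j _.
by rewrite (le_trans (ler_normB _ _))// !ger0_norm ?weight_ge0.
Qed.

Lemma dist1_vertex a i : dist1 a (vertex R i) = 2 * (1 - a i).
Proof.
rewrite /dist1 (bigD1 i)//= vertexE eqxx distrC ger0_norm ?subr_ge0 ?weight_le1//.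
rewrite (eq_bigr (fun j => a j)) => [|j /negbTE ji]; last first.
  by rewrite vertexE ji subr0 ger0_norm ?weight_ge0.
have := sum_weight a; rewrite (bigD1 i)//= => h.
by rewrite mulr_natl mulr2n; congr (_ + _); rewrite -h addrAC subrr add0r.
Qed.

Lemma weight_dist1 a b j : `|a j - b j| <= dist1 a b.
Proof. by rewrite /dist1 (bigD1 j)//= lerDl sumr_ge0. Qed.

Lemma dist1_sum a b (q : 'I_m.+1 -> R) B : (forall j, `|q j| <= B) ->
  `|\sum_j a j * q j - \sum_j b j * q j| <= B * dist1 a b.
Proof.
move=> qB; rewrite -sumrB (le_trans (ler_norm_sum _ _ _))// mulr_sumr.
by apply: ler_sum => j _; rewrite -mulrBl normrM mulrC ler_wpM2r.
Qed.

Lemma midpoint_subproof a b :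
  in_simplex (\row_j ((a j + b j) / 2) : 'rV[R]_m.+1).
Proof.
apply/andP; split.
  by apply/forallP => j; rewrite mxE divr_ge0// addr_ge0// weight_ge0.
under eq_bigr do rewrite mxE.
by rewrite -mulr_suml big_split/= !sum_weight -mulr2n divff.
Qed.

(** Iterating [midpoint a] halves the distance to [a], and each point is the midpoint of [a] and its
    predecessor. This lets an affine function at [a] be computed from two consecutive points. *)
Definition midpoint a b : simplex R m := Simplex (midpoint_subproof a b).

Lemma midpointE a b j : midpoint a b j = (a j + b j) / 2.
Proof. by rewrite /weight mxE. Qed.

Lemma iter_midpointE k a b j :
  iter k (midpoint a) b j = a j + 2^-1 ^+ k * (b j - a j).
Proof.
elim: k => [|k IH]; first by rewrite expr0 mul1r addrC subrK.
by rewrite iterS midpointE IH exprS; lra.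
Qed.

Lemma dist1_iter_midpoint k a b :
  dist1 (iter k (midpoint a) b) a = 2^-1 ^+ k * dist1 b a.
Proof.
rewrite /dist1 mulr_sumr; apply: eq_bigr => j _.
rewrite iter_midpointE addrAC subrr add0r normrM ger0_norm//.
Qed.

End Simplex.

Section Payoff.
Context {R : realType} {m : nat} (u : 'I_m.+1 -> action m -> R).
Implicit Types (a b : simplex R m) (x : action m).

Definition best a : R := payoff u a [arg max_(x > act_c) payoff u a x]%O.

Lemma payoff_le_best a x : payoff u a x <= best a.
Proof.
by rewrite /best; case: (@arg_maxP _ _ _ act_c predT) => // y _; exact.
Qed.

Lemma zstarE a x : (x \in zstar u a) = (payoff u a x == best a).
Proof.
rewrite inE; apply/forallP/eqP => [h|-> y]; last exact: payoff_le_best.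
by apply/le_anti; rewrite payoff_le_best /=; exact: h.
Qed.

Lemma zstar_best a x : x \in zstar u a -> payoff u a x = best a.
Proof. by rewrite zstarE => /eqP. Qed.

Lemma zstar_neq0 a : exists x, x \in zstar u a.
Proof. by exists [arg max_(x > act_c) payoff u a x]%O; rewrite zstarE. Qed.

Lemma payoff_vertex j x : payoff u (vertex R j) x = u j x.
Proof.
rewrite /payoff (bigD1 j)//= vertexE eqxx mul1r big1 ?addr0// => i /negbTE ij.
by rewrite vertexE ij mul0r.
Qed.

Lemma payoff_iter_midpoint k a b x : payoff u (iter k (midpoint a) b) x =
  payoff u a x + 2^-1 ^+ k * (payoff u b x - payoff u a x).
Proof.
rewrite /payoff -sumrB mulr_sumr -big_split/=; apply: eq_bigr => j _.
by rewrite iter_midpointE mulrDl -mulrA mulrBl.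
Qed.

Lemma payoff_le a x c : (forall j, u j x <= c) -> payoff u a x <= c.
Proof.
move=> uc; rewrite -[leRHS](sum_weight_cst a); apply: ler_sum => j _.
by rewrite ler_wpM2l ?weight_ge0.
Qed.

Lemma payoff_ge a x c : (forall j, c <= u j x) -> c <= payoff u a x.
Proof.
move=> uc; rewrite -[leLHS](sum_weight_cst a); apply: ler_sum => j _.
by rewrite ler_wpM2l ?weight_ge0.
Qed.

Lemma payoff_norm B a x : (forall j, `|u j x| <= B) -> `|payoff u a x| <= B.
Proof.
move=> uB; rewrite ler_norml payoff_le ?payoff_ge// => j;
  by have := uB j; rewrite ler_norml => /andP[].
Qed.

Lemma payoff_lip B a b x : (forall j x, `|u j x| <= B) ->
  `|payoff u a x - payoff u b x| <= B * dist1 a b.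
Proof. by move=> uB; exact: dist1_sum. Qed.

(** The maximizer at the better of the two worldviews is also available at the other, so the gap is
    at most the change in payoff of one action. *)
Lemma best_lip B a b : (forall j x, `|u j x| <= B) ->
  `|best a - best b| <= B * dist1 a b.
Proof.
move=> uB; wlog: a b / best b <= best a => [hw|].
  have [ba|/ltW ab] := leP (best b) (best a); first exact: hw.
  by rewrite distrC dist1C hw.
move=> ba; rewrite ger0_norm ?subr_ge0// lerBlDr {1}/best.
set x := [arg max_(_ > _) _]%O; rewrite -lerBlDr.
rewrite (le_trans _ (le_trans (ler_norm _) (payoff_lip a b x uB)))//.
by rewrite lerB// payoff_le_best.
Qed.

End Payoff.

(** The size of [B] never enters the final estimates; it serves convergence, integrability and
    Lipschitz continuity. *)
Lemma payoff_bounded {R : realType} {m : nat} (u : 'I_m.+1 -> action m -> R) :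
  exists B, forall j x, `|u j x| <= B.
Proof.
exists (\sum_j \sum_x `|u j x|) => j x.
rewrite (bigD1 j)//= (bigD1 x)//= -addrA lerDl addr_ge0// sumr_ge0// => i _.
by rewrite sumr_ge0.
Qed.

(** * Values supported by plans *)

(** [s b] is the mixed action played at [b], and [H b a] values at [a] the plan that follows the
    date spent at [b]. The left side of [vs_deviation] is thus the value at [a] of moving to [b] and
    following the strategy from there. The bound on the slopes in [vs_affine] is uniform in [b]. *)
Record value_system {R : realType} {m : nat} (u : 'I_m.+1 -> action m -> R)
    (lam delta : R) (s : simplex R m -> action m -> R)
    (F : simplex R m -> R) (H : simplex R m -> simplex R m -> R) : Prop :=
  ValueSystem {
    vs_ge0 : forall b x, 0 <= s b x;
    vs_sum : forall b, \sum_x s b x = 1;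
    vs_supp : forall b x, x \notin zstar u b -> s b x = 0;
    vs_affine : exists K Q B, (forall b j, `|Q b j| <= B) /\
      forall b a, H b a = K b + \sum_j a j * Q b j;
    vs_le : forall b a, H b a <= F a;
    vs_eq : forall a, H a a = F a;
    vs_deviation : forall b a,
      (1 - lam) * best u b + lam * (\sum_x s b x * payoff u a x) + delta * H b a
        <= F a }.

Section ValueSystem.
Context {R : realType} {m : nat} (u : 'I_m.+1 -> action m -> R) (lam delta : R)
  (s : simplex R m -> action m -> R) (F : simplex R m -> R)
  (H : simplex R m -> simplex R m -> R).
Hypotheses (lam_gt0 : 0 < lam) (lam_lt1 : lam < 1)
  (delta_gt0 : 0 < delta) (delta_lt1 : delta < 1)
  (vs : value_system u lam delta s F H).
Implicit Types (a b : simplex R m).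

Lemma mixed_payoff_le b a : \sum_x s b x * payoff u a x <= best u a.
Proof.
rewrite -[leRHS]mul1r -(vs_sum vs b) mulr_suml; apply: ler_sum => x _.
by rewrite ler_wpM2l ?(vs_ge0 vs)// payoff_le_best.
Qed.

Lemma mixed_payoff_best b a : {subset zstar u b <= zstar u a} ->
  \sum_x s b x * payoff u a x = best u a.
Proof.
move=> sub; rewrite -[RHS]mul1r -(vs_sum vs b) mulr_suml; apply: eq_bigr => x _.
have [/sub/zstar_best->//|/(vs_supp vs)->] := boolP (x \in zstar u b).
by rewrite !mul0r.
Qed.

Lemma best_le_value a : best u a <= (1 - delta) * F a.
Proof.
have := vs_deviation vs a a; rewrite mixed_payoff_best// (vs_eq vs).
lra.
Qed.

(** [H a] meets [F] at [a] and lies below it at [b], so [F a - F b] is at most the change of the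
    affine function [H a]; its slopes are bounded uniformly in [a]. *)
Lemma value_lip : exists2 B, 0 <= B & forall a b, `|F a - F b| <= B * dist1 a b.
Proof.
have [K [Q [B [QB HE]]]] := vs_affine vs.
have B0 : 0 <= B := le_trans (normr_ge0 _) (QB (barycenter R m) ord0).
have lip a b : F a - F b <= B * dist1 a b.
  rewrite -(vs_eq vs a) lerBlDr.
  have := vs_le vs a b.
  have := dist1_sum a b (QB a); rewrite ler_norml => /andP[_].
  by rewrite !HE; lra.
exists B => // a b; rewrite ler_norml lip andbT lerNl opprB dist1C; exact: lip.
Qed.

(** There are finitely many actions, and a strict payoff gap at [a] survives close to [a]. Hence the
    mixed action used near [a] is optimal at [a] as well, and [mixed_payoff_best] applies to it. *)
Lemma zstar_iter_midpoint a b :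
  \forall k \near \oo, {subset zstar u (iter k (midpoint a) b) <= zstar u a}.
Proof.
have [w wa] := zstar_neq0 u a.
suff: \forall k \near \oo, forall x, x \notin zstar u a ->
    payoff u (iter k (midpoint a) b) x < payoff u (iter k (midpoint a) b) w.
  apply: filterS => k hk x; apply: contraLR => /hk; apply: contraTN.
  by rewrite -leNgt => /zstar_best ->; exact: payoff_le_best.
apply: filter_forall => x.
have [xa|xa] := boolP (x \in zstar u a); first by near=> k.
have gap : payoff u a x < payoff u a w.
  rewrite (zstar_best wa) lt_neqAle payoff_le_best andbT.
  by rewrite -zstarE.
have cv c d : payoff u (iter k (midpoint a) b) c - payoff u (iter k (midpoint a) b) d
   @[k --> \oo] --> payoff u a c - payoff u a d.
  have g0 : geometric (payoff u b c - payoff u a c - (payoff u b d - payoff u a d))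
      2^-1 @ \oo --> (0 : R).
    by apply: cvg_geometric; rewrite ger0_norm// invf_lt1// ltr1n.
  rewrite [X in X @ _](_ : _ = (fun=> payoff u a c - payoff u a d) + geometric
    (payoff u b c - payoff u a c - (payoff u b d - payoff u a d)) 2^-1); last first.
    by apply/funext => k; rewrite fctE /= !payoff_iter_midpoint; lra.
  suff: (fun=> payoff u a c - payoff u a d) + geometric
    (payoff u b c - payoff u a c - (payoff u b d - payoff u a d)) 2^-1 @ \oo -->
      payoff u a c - payoff u a d + 0 by rewrite addr0.
  by apply: cvgD g0; exact: cvg_cst.
have : \forall k \near \oo, payoff u (iter k (midpoint a) b) x -
    payoff u (iter k (midpoint a) b) w < 0.
  by apply: (cvgr_lt _ (cv x w)); rewrite subr_lt0.
by apply: filterS => k; rewrite subr_lt0.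
Unshelve. all: by end_near. Qed.

(* Deviate from a to the points b_k = a + 2^-k (b_0 - a) with b_0 the vertex j.
   By affinity the support at b_k gives H b_k a >= 2 F b_k - F b_(k-1), so a
   first-order gain of best along (b_k) would make the difference quotients
   2^k (F b_k - F a) decrease by a fixed amount at each step, although F is
   Lipschitz. *)
Lemma stationary_payoff_max a x j : best u a = (1 - delta) * F a ->
  x \in zstar u a -> u j x <= payoff u a x.
Proof.
move=> stat xa; rewrite leNgt; apply/negP => ujx.
set kappa := u j x - payoff u a x.
have kappa_gt0 : 0 < kappa by rewrite subr_gt0.
pose b k := iter k (midpoint a) (vertex R j).
have best_b k : best u a + 2^-1 ^+ k * kappa <= best u (b k).
  apply: le_trans (payoff_le_best u (b k) x).
  by rewrite payoff_iter_midpoint payoff_vertex /kappa (zstar_best xa).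
have [B B0 Flip] := value_lip.
pose h k := 2 ^+ k * (F (b k) - F a).
have h_bound k : `|h k| <= B * 2.
  rewrite normrM ger0_norm ?exprn_ge0// (le_trans (ler_wpM2l _ (Flip _ _)))//.
  rewrite dist1_iter_midpoint [leLHS](_ : _ =
    B * ((2 * 2^-1) ^+ k * dist1 (vertex R j) a)); last by rewrite exprMn; ring.
  by rewrite divff// expr1n mul1r ler_wpM2l// dist1_le2.
have half k : H (b k.+1) a = 2 * F (b k.+1) - H (b k.+1) (b k).
  have [K [Q [C [_ HE]]]] := vs_affine vs.
  rewrite -(vs_eq vs (b k.+1)) !HE.
  have -> : \sum_i b k.+1 i * Q (b k.+1) i =
      (\sum_i a i * Q (b k.+1) i + \sum_i b k i * Q (b k.+1) i) / 2.
    rewrite -big_split mulr_suml; apply: eq_bigr => i _.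
    have -> : b k.+1 i = (a i + b k i) / 2 by exact: midpointE.
    by rewrite /=; ring.
  lra.
(* With e = 2^-(k+1), the deviation to [b k.+1] reads [2 * delta * e * (h k.+1 - h k) <= - (1 - lam)
   * kappa * e]: here [best] gains at least [e * kappa], [F (b k.+1) = F a + e * h k.+1] and
   [F (b k) = F a + 2 * e * h k]. *)
pose c := (1 - lam) * kappa / (2 * delta).
have c_gt0 : 0 < c by rewrite divr_gt0 ?mulr_gt0// subr_gt0.
have h_step : \forall k \near \oo, h k.+1 <= h k - c.
  have near_a := zstar_iter_midpoint a (vertex R j).
  have [N _ HN] := near_a.
  exists N => // k Nk.
  have := vs_deviation vs (b k.+1) a.
  rewrite mixed_payoff_best ?half; last by apply: HN => /=; exact: leqW.
  move: (best_b k.+1) (vs_le vs (b k.+1) (b k)) => bk Hle dev.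
  have e0 : 0 < 2^-1 ^+ k.+1 :> R by rewrite exprn_gt0.
  have hS l : F (b l) = F a + 2^-1 ^+ l * h l.
    rewrite /h mulrA -exprMn mulVf// expr1n mul1r; lra.
  have e1 : 2^-1 ^+ k = 2 * 2^-1 ^+ k.+1 :> R by rewrite exprS; lra.
  suff : 2^-1 ^+ k.+1 * (2 * delta * h k.+1) <=
         2^-1 ^+ k.+1 * (2 * delta * (h k - c)).
    by rewrite ler_pM2l// ler_pM2l// mulr_gt0.
  have -> : 2 * delta * (h k - c) = 2 * delta * h k - (1 - lam) * kappa.
    by rewrite /c; field; rewrite gt_eqF.
  have bk' := ler_wpM2l (ltW (_ : 0 < 1 - lam)) bk.
  have {}bk' := bk' ltac:(by rewrite subr_gt0).
  have Hle' := ler_wpM2l (ltW delta_gt0) Hle.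
  have h1 := hS k.+1; have h0 := hS k; rewrite e1 in h0.
  rewrite h1 h0 stat in dev bk' Hle' *.
  nra.
have [N _ HN] := h_step.
have h_dec n : h (N + n)%N <= h N - c *+ n.
  elim: n => [|n IH]; first by rewrite addn0 mulr0n subr0.
  rewrite addnS mulrS; move: (HN (N + n)%N (leq_addr _ _)) IH.
  by move: (c *+ n) => cn; lra.
(* Since [h] stays within [[- 2 B, 2 B]], its total decrease cannot exceed [4 B]; this many steps of
   size [c] do. *)
have := h_dec (Num.truncn (B * 4 / c)).+1.
have := h_bound N; have := h_bound (N + (Num.truncn (B * 4 / c)).+1)%N.
rewrite !ler_norml => /andP[h1 _] /andP[_ h2].
have : B * 4 / c < (Num.truncn (B * 4 / c)).+1%:R by exact: truncnS_gt.
rewrite ltr_pdivrMr// -[c *+ _]mulr_natl.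
lra.
Qed.

End ValueSystem.

(** * Convergence of equilibrium paths *)

Section SimplexTopology.
Context {R : realType} {m : nat}.
Implicit Types (a p : simplex R m).

Lemma compact_simplex : compact [set v : 'rV[R]_m.+1 | in_simplex v].
Proof.
have cube : compact [set v : 'rV[R]_m.+1 | forall i, `[(0:R), 1]%classic (v ord0 i)].
  by apply: (@rV_compact R m.+1 (fun=> `[0, 1]%classic)) => _; exact: segment_compact.
apply: subclosed_compact cube _.
- rewrite (_ : mkset _ = (\bigcap_(j in [set: 'I_m.+1])
      (fun v : 'rV[R]_m.+1 => v ord0 j) @^-1` [set x | 0 <= x]) `&`
      (fun v : 'rV[R]_m.+1 => \sum_j v ord0 j) @^-1` [set x | x = 1]); last first.
    apply/seteqP; split => [v /andP[/forallP v0 /eqP v1]|v [v0 v1]].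
    by split => [j _|]; [exact: v0|exact: v1].
    by apply/andP; split; [apply/forallP => j; exact: v0|exact/eqP].
  apply: closedI.
    apply: closed_bigI => j _; apply: preimage_closed; last exact: closed_ge.
    by move=> v _; exact: coord_continuous.
  apply: preimage_closed; last exact: closed_eq.
  move=> v _; apply: continuous_big; first exact: add_continuous.
  by move=> j _; exact: coord_continuous.
- move=> v vS i; rewrite /= in_itv/=.
  by rewrite (weight_ge0 (Simplex vS)) (weight_le1 (Simplex vS)).
Qed.

(** Translates between the topology, which lives on coordinate vectors, and the distance [dist1] on
    worldviews. *)
Lemma nbhs_coords_dist1 p e : 0 < e ->
  nbhs (coords p) [set v | forall a, coords a = v -> dist1 a p < e].
Proof.
(* There are [m.+1] coordinates, so dividing by [m.+2] keeps their total strictly below [e]. *)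
move=> e0; apply/nbhs_ballP; exists (e / m.+2%:R) => /=; first by rewrite divr_gt0.
move=> v [_ pv] a av; apply: (@le_lt_trans _ _ (\sum_(j < m.+1) e / m.+2%:R)).
  apply: ler_sum => j _; rewrite /weight av distrC.
  by have := pv ord0 j; rewrite /ball/= => /ltW.
rewrite sumr_const card_ord -[_ *+ _]mulr_natr -mulrA gtr_pMr//.
by rewrite mulrC ltr_pdivrMr// mul1r ltr_nat.
Qed.

Lemma cvg_coords_dist1 (al : nat -> simplex R m) p :
  (forall e, 0 < e -> \forall t \near \oo, dist1 (al t) p < e) ->
  coords (al t) @[t --> \oo] --> coords p.
Proof.
move=> h; apply/cvg_ballP => e e0; have := h e e0; apply: filterS => t te.
split => // i j; rewrite (ord1 i) -ball_normE /=.
by apply: le_lt_trans te; rewrite dist1C; exact: weight_dist1.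
Qed.

End SimplexTopology.

Section PathConvergence.
Context {R : realType} {m : nat} (u : 'I_m.+1 -> action m -> R) (lam delta : R)
  (s : simplex R m -> action m -> R) (F : simplex R m -> R)
  (H : simplex R m -> simplex R m -> R).
Hypotheses (lam_gt0 : 0 < lam) (lam_lt1 : lam < 1)
  (delta_gt0 : 0 < delta) (delta_lt1 : delta < 1)
  (vs : value_system u lam delta s F H).
Implicit Types (a b : simplex R m).

Let slack a : R := (1 - delta) * F a - best u a.

(** An action [x] optimal at [a] is implementable, so one model is its strict favourite. By
    [stationary_payoff_max] the average of [u j x] under [a] reaches that maximal payoff, which
    leaves no weight for the other models. *)
Lemma stationary_vertex a :
  (forall x, implementable u x -> #|argmax (fun j => u j x)| = 1%N) ->
  best u a = (1 - delta) * F a -> exists i, a = vertex R i.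
Proof.
move=> uniq stat; have [x xa] := zstar_neq0 u a.
have /uniq/eqP/cards1P[i iE] : implementable u x by exists a.
have iP j : u j x <= u i x.
  have : i \in argmax (fun j => u j x) by rewrite iE finset.in_set1.
  by rewrite finset.inE => /forallP; exact.
have iP' j : j != i -> u j x < u i x.
  move=> ji; rewrite lt_neqAle iP andbT; apply: contra ji => /eqP uji.
  by rewrite -finset.in_set1 -iE finset.inE; apply/forallP => k; rewrite uji iP.
have := stationary_payoff_max lam_lt1 delta_gt0 vs i stat xa.
rewrite -(sum_weight_cst a (u i x)) -subr_le0 -sumrB => sum_le0.
have a0 j : j != i -> a j = 0.
  move=> ji; apply/eqP; rewrite eq_le weight_ge0 andbT -(pmulr_lle0 _ (_ : 0 < u i x - u j x)).
    2: by rewrite subr_gt0 iP'.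
  apply: le_trans sum_le0; rewrite (bigD1 j)//= -mulrBr mulrC lerDl.
  apply: sumr_ge0 => k _; rewrite -mulrBr mulr_ge0 ?weight_ge0// subr_ge0//.
exists i; apply: simplex_eqP => j; rewrite vertexE; have [->|/a0//] := eqVneq j i.
by have := sum_weight a; rewrite (bigD1 i)//= big1 ?addr0// => k /a0.
Qed.

Lemma slack_lip : exists2 B, 0 <= B & forall a b, slack a <= slack b + B * dist1 a b.
Proof.
have [B B0 FB] := value_lip vs; have [C uC] := payoff_bounded u.
exists (B + C).
  by rewrite addr_ge0// (le_trans (normr_ge0 _) (uC ord0 act_c)).
move=> a b; rewrite /slack.
have := FB a b; have := best_lip a b uC.
rewrite !ler_norml => /andP[h1 _] /andP[_ h2].
have d0 := dist1_ge0 a b.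
have : (1 - delta) * (F a - F b) <= (1 - delta) * (B * dist1 a b).
  by rewrite ler_wpM2l// subr_ge0 ltW.
have : (1 - delta) * (B * dist1 a b) <= B * dist1 a b.
  by rewrite ler_piMl ?mulr_ge0// gerBl ltW.
lra.
Qed.

Hypothesis stat_vertex :
  forall a, best u a = (1 - delta) * F a -> exists i, a = vertex R i.

(** Otherwise some worldviews with slack tending to 0 stay [e] away from all vertices. By
    compactness they cluster at a worldview of zero slack, which [stat_vertex] identifies as a
    vertex. *)
Lemma small_slack_vertex e : 0 < e -> exists2 eta, 0 < eta &
  forall a, slack a < eta -> exists i, dist1 a (vertex R i) < e.
Proof.
move=> e0; apply: contrapT => no.
have bad (k : nat) : exists a, slack a < k.+1%:R^-1 /\
    forall i, e <= dist1 a (vertex R i).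
  apply: contrapT => nok; apply: no; exists k.+1%:R^-1; first by rewrite invr_gt0.
  move=> a ak; apply: contrapT => noi; apply: nok; exists a; split => // i.
  by rewrite leNgt; apply/negP => ai; apply: noi; exists i.
have [a aP] := choice bad.
have [|p [pS pcl]] := @compact_simplex R m (coords (a k) @[k --> \oo]) _.
  by exists 0%N => // k _; exact: simplexP.
pose q := Simplex pS; have close r N : 0 < r -> exists2 k, (N <= k)%N & dist1 (a k) q < r.
  move=> r0; have [|v [[k Nk <-] /(_ (a k))]] :=
      pcl [set coords (a k) | k in [set k | (N <= k)%N]] _ _ (nbhs_coords_dist1 q r0).
    by exists N => // k Nk /=; exists k.
  by move=> /(_ erefl); exists k.
have [B B0 sB] := slack_lip.
have q0 : slack q <= 0.
  apply/ler_addgt0Pr => r r0; rewrite add0r.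
  have r2 : 0 < r / 2 by rewrite divr_gt0.
  have B1 : 0 < B + 1 by rewrite ltr_wpDl.
  (* Half of [r] covers the slack of [a k], below [1 / k.+1]; the other half covers the Lipschitz
     term. [B + 1] replaces [B], which may be 0. *)
  have [k kN kr] := close (r / 2 / (B + 1)) (Num.truncn (r / 2)^-1) (divr_gt0 r2 B1).
  rewrite (le_trans (sB q (a k)))// [r]splitr lerD//.
    apply: le_trans (ltW (aP k).1) _; rewrite invf_ple ?posrE//.
    by apply: ltW; apply: lt_le_trans (truncnS_gt _) _; rewrite ler_nat.
  have := ler_wpM2l (ltW B1) (ltW kr); rewrite [leRHS]mulrC divfK ?gt_eqF//.
  by apply: le_trans; rewrite dist1C ler_wpM2r ?dist1_ge0// lerDl.
have [|i qi] := stat_vertex (a := q).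
  by apply/eqP; rewrite eq_le (best_le_value vs) -subr_le0.
have [k _] := close e 0%N e0; rewrite qi ltNge => /negP; apply.
exact: (aP k).2.
Qed.

(** [y i] is the action that beats all others by [gap] near the vertex [i]; injectivity ties each
    such action to one vertex. The inequality in [alpha t] and [alpha t.+1] expresses optimality of
    the step, and holds along deterministic paths and along almost every random one. *)
Lemma path_cvg (alpha : nat -> simplex R m) (y : 'I_m.+1 -> action m) (e0 gap : R) :
  injective y -> 0 < e0 -> e0 <= 1 -> 0 < gap ->
  (forall a i, dist1 a (vertex R i) < e0 ->
     forall x, x != y i -> payoff u a x + gap <= best u a) ->
  (forall t, (1 - delta) * F (alpha t) <= (1 - lam) * best u (alpha t.+1) +
     lam * \sum_x s (alpha t.+1) x * payoff u (alpha t) x) ->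
  exists i, coords (alpha t) @[t --> \oo] --> coords (vertex R i).
Proof.
move=> yI e0_gt0 e0_le1 gap_gt0 gapP step.
pose d t := best u (alpha t.+1) - best u (alpha t).
have mixed t := mixed_payoff_le vs (alpha t.+1) (alpha t).
have value t := best_le_value vs (alpha t).
have d_ge0 t : 0 <= d t.
  move: (step t) (value t) (mixed t).
  rewrite /d -(pmulr_rge0 _ (_ : 0 < 1 - lam)) ?subr_gt0//.
  by move=> h1 h2 /(ler_wpM2l (ltW lam_gt0)); lra.
have [B uB] := payoff_bounded u.
have d_cvg0 : d t @[t --> \oo] --> (0 : R).
  have cv : cvgn (best u \o alpha).
    apply: nondecreasing_is_cvgn.
      by apply/nondecreasing_seqP => t; rewrite -subr_ge0 d_ge0.
    exists B => _ [t _ <-] /=.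
    by have := payoff_norm (alpha t) (uB ^~ _); rewrite /best => /(_ _)/ler_normlW.
  rewrite -(subrr (limn (best u \o alpha))); apply: cvgB => //.
  by rewrite (cvg_shiftS (best u \o alpha)).
(* The slack at date [t] is at most [(1 - lam) * d t], hence tends to 0. *)
have close e : 0 < e -> \forall t \near \oo, exists i, dist1 (alpha t) (vertex R i) < e.
  move=> /small_slack_vertex[eta eta0 etaP].
  have /(cvgr_lt _)/(_ _ eta0) := d_cvg0; apply: filterS => t dt; apply: etaP.
  apply: le_lt_trans dt; rewrite /slack /d.
  move: (step t) (ler_wpM2l (ltW lam_gt0) (mixed t)) (d_ge0 t); rewrite /d => h1 h2 h3.
  have := mulr_ge0 (ltW lam_gt0) h3; lra.
have lg : 0 < lam * gap by rewrite mulr_gt0.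
have small : \forall t \near \oo, d t < lam * gap.
  by have /(cvgr_lt _)/(_ _ lg) := d_cvg0.
have [N _ HN] : \forall t \near \oo, d t < lam * gap /\
    exists i, dist1 (alpha t) (vertex R i) < e0.
  by near=> t; split; [near: t|near: t; exact: close].
(* Were [alpha t.+1] near another vertex, [y i] would not be played there, so the action played
   would lose at least [gap] when valued at [alpha t]. Optimality of the step would then give
   [lam * gap <= (1 - lam) * d t], which fails from [N] on. *)
have persist t i : (N <= t)%N -> dist1 (alpha t) (vertex R i) < e0 ->
    dist1 (alpha t.+1) (vertex R i) < e0.
  move=> Nt ti; have [dt _] := HN _ Nt.
  have [_ [k tk]] := HN _ (leqW Nt).
  suff -> : i = k by [].
  apply/yI/eqP/negPn/negP => yik.
  have yi0 : s (alpha t.+1) (y i) = 0.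
    apply: (vs_supp vs); rewrite zstarE lt_eqF//.
    by have := gapP _ _ tk _ yik; apply: lt_le_trans; rewrite ltrDl.
  have : \sum_x s (alpha t.+1) x * payoff u (alpha t) x <= best u (alpha t) - gap.
    rewrite -[leRHS]mul1r -(vs_sum vs (alpha t.+1)) mulr_suml; apply: ler_sum => x _.
    have [->|/(gapP _ _ ti) xy] := eqVneq x (y i); first by rewrite yi0 !mul0r.
    by rewrite ler_wpM2l ?(vs_ge0 vs)// lerBrDr.
  move=> /(ler_wpM2l (ltW lam_gt0)); move: (step t) (value t) dt.
  have := mulr_ge0 (ltW lam_gt0) (d_ge0 t); rewrite /d; lra.
have [_ [i iN]] := HN _ (leqnn N).
have stay t : (N <= t)%N -> dist1 (alpha t) (vertex R i) < e0.
  move=> /subnK <-; elim: (t - N)%N => [//|k IH]; rewrite addSn.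
  by apply: persist => //; exact: leq_addl.
exists i; apply: cvg_coords_dist1 => e egt0.
have ee0 : 0 < Num.min e e0 by rewrite lt_min egt0.
have [N' _ HN'] := close _ ee0.
exists (maxn N N') => // t /=; rewrite geq_max => /andP[/stay ti /HN'[k]].
rewrite lt_min => /andP[tk tk'].
suff -> : i = k by [].
apply/eqP/negPn/negP => ik.
(* Distance below [e0 <= 1] from a vertex means weight above 1/2 on it, possible for one vertex
   only. *)
move: ti tk'; rewrite !dist1_vertex => ti tk'.
have := sum_weight (alpha t); rewrite (bigD1 i)//= (bigD1 k) 1?eq_sym//=.
have : 0 <= \sum_(j < m.+1 | (j != i) && (j != k)) alpha t j.
  by apply: sumr_ge0 => j _; exact: weight_ge0.
lra.
Unshelve. all: by end_near. Qed.

End PathConvergence.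

(** * The perturbed game *)

Section Tau.
Context {R : realType} {m : nat}.
Implicit Types (xs : nat -> action m).

(** Dates are integers: without an exit by [T] the infimum is at least [T.+1], so passing to the
    infimum cannot produce the value [T]. *)
Lemma tau_leP xs T : reflect (exists2 t, (1 <= t <= T)%N & xs t != act_c)
  (tau xs <= (T%:R : R)%:E)%E.
Proof.
apply: (iffP idP) => [|[t /andP[t1 tT] xt]]; last first.
  apply: (@le_trans _ _ t%:R%:E); last by rewrite lee_fin ler_nat.
  by apply: ereal_inf_lbound; exists t => //; split => //; exact/eqP.
apply: contraPP => no; apply/negP; rewrite -ltNge.
apply: (@lt_le_trans _ _ (T.+1%:R%:E)); first by rewrite lte_fin ltr_nat.
apply: le_ereal_inf_tmp => _ [t [t1 xt] <-]; rewrite lee_fin ler_nat ltnNge.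
by apply/negP => tT; apply: no; exists t; [rewrite t1|exact/eqP].
Qed.

(** An equality of propositions, so that it can rewrite the body of a set of paths or outcomes. *)
Lemma tau_gtE xs T : (((T%:R : R)%:E < tau xs)%E : Prop) =
  forall t, (1 <= t <= T)%N -> xs t = act_c.
Proof.
rewrite ltNge; apply/propext; split => [/tau_leP no t tT|all_c].
  by apply/eqP/negPn/negP => xt; apply: no; exists t.
by apply/tau_leP => -[t /all_c ->]; rewrite eqxx.
Qed.

Lemma tau_lt_pinfty xs t : (1 <= t)%N -> xs t != act_c -> (tau xs < +oo :> \bar R)%E.
Proof.
move=> t1 xt; apply: le_lt_trans (ltry (t%:R : R)); apply/tau_leP.
by exists t => //; rewrite t1 leqnn.
Qed.

End Tau.

Section Thresholds.
Context {R : realType} {m : nat} (n_ge2 : (2 <= m.+1)%N) (M lam : R)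
  (M_gt : 1 / (m.+1%:R - 1) < M).

Let n1_gt0 : 0 < m.+1%:R - 1 :> R.
Proof. by rewrite subr_gt0 ltr1n. Qed.

Lemma M_gt0 : 0 < M.
Proof. by apply: lt_trans M_gt; rewrite divr_gt0. Qed.

Lemma d0_gt0 : 0 < d0_param m.+1 M.
Proof.
rewrite divr_gt0// subr_gt0 mulrC -ltr_pdivrMr//.
Qed.

(** At [lam = lambda_c] one has [(1 - lam) * 1 = lam * d0]: the largest current payoff from an
    action other than [act_c] exactly offsets the loss [d0] seen from the barycenter. *)
Lemma lambda_cE : (lambda_c m.+1 M)^-1 = 1 + d0_param m.+1 M.
Proof.
have n0 : m.+1%:R != 0 :> R by rewrite pnatr_eq0.
by rewrite /lambda_c /d0_param invf_div; field.
Qed.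

Lemma b_paramE : b_param m.+1 M lam = lam * (1 + d0_param m.+1 M) - 1.
Proof. by rewrite /b_param lambda_cE. Qed.

Lemma lambda_c_gt0 : 0 < lambda_c m.+1 M.
Proof. by rewrite -invr_gt0 lambda_cE addr_gt0// d0_gt0. Qed.

Lemma b_param_gt0 : lambda_c m.+1 M < lam -> 0 < b_param m.+1 M lam.
Proof.
by move=> h; rewrite subr_gt0 ltr_pdivlMr ?lambda_c_gt0// mul1r.
Qed.

End Thresholds.

Section PerturbedPayoffs.
Context {R : realType} {m : nat} (n_ge2 : (2 <= m.+1)%N) (M lam rho : R)
  (u : 'I_m.+1 -> action m -> R).
Hypotheses (M_gt : 1 / (m.+1%:R - 1) < M) (rho_gt0 : 0 < rho)
  (rho_lt : rho < Num.min (d0_param m.+1 M / 2) (1 / 2))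
  (u_dist : payoff_dist u (base_payoff M) <= rho).
Implicit Types (a : simplex R m).

Let d0 := d0_param m.+1 M.

Let rho_d0 : 2 * rho < d0.
Proof. by move: rho_lt; rewrite lt_min ltr_pdivlMr// mulrC => /andP[]. Qed.

Let rho_half : 2 * rho < 1.
Proof. by move: rho_lt; rewrite lt_min !ltr_pdivlMr// [rho * 2]mulrC => /andP[]. Qed.

Let M0 : 0 < M := M_gt0 n_ge2 M_gt.

Lemma payoff_dist_le j x : `|u j x - base_payoff M j x| <= rho.
Proof.
apply: le_trans u_dist; rewrite /payoff_dist.
apply: (le_trans _ (@le_bigmax_cond _ _ _ 0 _ predT
  (fun j => \big[Order.max/0]_x `|u j x - base_payoff M j x|) _)) => //.
exact: (@le_bigmax_cond _ _ _ 0 _ predT (fun x => `|u j x - base_payoff M j x|)).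
Qed.

Lemma payoff_base_c a : payoff (base_payoff M) a act_c = 0.
Proof. by rewrite /payoff big1// => j _; rewrite mulr0. Qed.

Lemma payoff_base_a a i : payoff (base_payoff M) a (Some i) = (1 + M) * a i - M.
Proof.
rewrite /payoff (bigD1 i)//= eqxx (eq_bigr (fun j => a j * - M)); last first.
  by move=> j /negbTE ji; rewrite ji.
have := sum_weight a; rewrite (bigD1 i)//= -mulr_suml.
by move: (\sum_(j < m.+1 | j != i) a j) => S; nra.
Qed.

Lemma payoff_perturbed a x : `|payoff u a x - payoff (base_payoff M) a x| <= rho.
Proof.
rewrite /payoff -sumrB (le_trans (ler_norm_sum _ _ _))//.
rewrite -[leRHS](sum_weight_cst a); apply: ler_sum => j _.
by rewrite -mulrBr normrM ger0_norm ?weight_ge0// ler_wpM2l ?weight_ge0 ?payoff_dist_le.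
Qed.

Lemma payoff_c a : - rho <= payoff u a act_c <= rho.
Proof. by have := payoff_perturbed a act_c; rewrite payoff_base_c subr0 ler_norml. Qed.

Lemma payoff_a a i : (1 + M) * a i - M - rho <= payoff u a (Some i) <=
  (1 + M) * a i - M + rho.
Proof.
have := payoff_perturbed a (Some i); rewrite payoff_base_a ler_norml.
by move=> /andP[? ?]; apply/andP; split; lra.
Qed.

Lemma best_ge a : - rho <= best u a.
Proof. by have /andP[h _] := payoff_c a; exact: le_trans h (payoff_le_best _ _ _). Qed.

(** [Some i] must not beat [act_c], so [(1 + M) * a i - M - rho <= rho]. *)
Lemma safe_weight a i : act_c \in zstar u a -> a i <= (M + 2 * rho) / (1 + M).
Proof.
move=> /zstar_best ac; have := payoff_le_best u a (Some i).
rewrite ler_pdivlMr ?addr_gt0// -ac.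
by have /andP[_] := payoff_c a; have /andP[+ _] := payoff_a a i; lra.
Qed.

Lemma safe_distance_gt0 : 0 < 2 * (1 - 2 * rho) / (1 + M).
Proof. by rewrite divr_gt0 ?(addr_gt0 ltr01 M0)// mulr_gt0// subr_gt0. Qed.

Lemma safe_far a : act_c \in zstar u a ->
  [/\ max_weight a <= (M + 2 * rho) / (1 + M),
      2 * (1 - 2 * rho) / (1 + M) <= dist1_set a (@pure_worldviews R m) &
      0 < 2 * (1 - 2 * rho) / (1 + M)].
Proof.
move=> ac; have M1 : 0 < 1 + M by rewrite addr_gt0.
split.
- apply: bigmax_le => [|i _]; last exact: safe_weight.
  by rewrite divr_ge0 ?addr_ge0 ?mulr_ge0// ltW.
- apply: lb_le_inf; first by exists (dist1 a (vertex R ord0)), (vertex R ord0) => //; exists ord0.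
  move=> _ [_ [i _ <-] <-]; rewrite dist1_vertex -mulrA ler_pM2l//.
  by have := safe_weight i ac; rewrite ler_pdivlMr// ler_pdivrMr//; lra.
- exact: safe_distance_gt0.
Qed.

Lemma barycenterE i : barycenter R m i = m.+1%:R^-1.
Proof. by rewrite /weight mxE mul1r. Qed.

(** With n states, [- d0] equals (1 + M)/n - M, the unperturbed payoff of each [Some i] at the
    barycenter. *)
Lemma payoff_barycenter_a i : payoff u (barycenter R m) (Some i) <= - d0 + rho.
Proof.
have /andP[_] := payoff_a (barycenter R m) i; rewrite barycenterE => /le_trans; apply.
rewrite lerD2r /d0 /d0_param le_eqVlt; apply/orP; left; apply/eqP.
by have n0 : m.+1%:R != 0 :> R; [rewrite pnatr_eq0|field].
Qed.

(** Uses [2 * rho < d0]. It rules out an exit at date 0. *)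
Lemma zstar_barycenter x : x \in zstar u (barycenter R m) -> x = act_c.
Proof.
case: x => [i|//] /zstar_best xa; exfalso; have := payoff_le_best u (barycenter R m) act_c.
rewrite -xa; have := payoff_barycenter_a i; have /andP[+ _] := payoff_c (barycenter R m).
by move: rho_d0; lra.
Qed.

(** If [x] is some [Some i], the payoff at [a] is at most [1 + rho] and the one at the barycenter at
    most [- d0 + rho]. Their mixture is at most [rho + 1 - lam * (1 + d0)], that is [rho - b]. *)
Lemma flow_barycenter_le a x : 0 < lam -> lam < 1 ->
  (1 - lam) * payoff u a x + lam * payoff u (barycenter R m) x <=
    rho - b_param m.+1 M lam * (x != act_c)%:R.
Proof.
move=> lam0 lam1; rewrite b_paramE -/d0; case: x => [i|] /=.
  have /andP[_ h1] := payoff_a a i; have h2 := payoff_barycenter_a i.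
  have h3 : payoff u a (Some i) <= 1 + rho.
    apply: le_trans h1 _; have := weight_le1 a i; rewrite -(ler_pM2l (_ : 0 < 1 + M)).
      2: by rewrite addr_gt0.
    by lra.
  have h4 := ler_wpM2l (ltW lam0) h2.
  have : (1 - lam) * payoff u a (Some i) <= (1 - lam) * (1 + rho).
    by rewrite ler_wpM2l// subr_ge0 ltW.
  by rewrite mulr1; lra.
have /andP[_ h1] := payoff_c a; have /andP[_ h2] := payoff_c (barycenter R m).
have h4 := ler_wpM2l (ltW lam0) h2.
have : (1 - lam) * payoff u a act_c <= (1 - lam) * rho.
  by rewrite ler_wpM2l// subr_ge0 ltW.
by rewrite mulr0; lra.
Qed.

Lemma gap_near_vertex : exists e0 gap, [/\ 0 < e0, e0 <= 1, 0 < gap &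
  forall a i, dist1 a (vertex R i) < e0 ->
    forall x, x != Some i -> payoff u a x + gap <= best u a].
Proof.
have M1 : 0 < 1 + M by rewrite addr_gt0.
(* Put q = (1 + M)(1 - a_i). Then [Some i] pays at least 1 - q - rho and any other action at most q
   + rho. This [e0] gives q < (1 - 2 rho)/4, so the difference exceeds (1 - 2 rho)/2. *)
exists ((1 - 2 * rho) / (2 * (1 + M))), ((1 - 2 * rho) / 2); split.
- by rewrite divr_gt0 ?mulr_gt0// subr_gt0.
- by rewrite ler_pdivrMr ?mulr_gt0// mul1r; move: M0 rho_gt0; lra.
- by rewrite divr_gt0// subr_gt0.
move=> a i; rewrite dist1_vertex ltr_pdivlMr ?mulr_gt0// => ai x xi.
apply: le_trans (payoff_le_best u a (Some i)).
have /andP[h1 _] := payoff_a a i.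
suff: payoff u a x <= (1 + M) * (1 - a i) + rho by move: rho_half; lra.
case: x xi => [k|] ki; last first.
  have /andP[_ /le_trans] := payoff_c a; apply.
  by rewrite lerDr mulr_ge0 ?subr_ge0 ?weight_le1// ltW.
have {}ki : k != i by apply: contra ki => /eqP ->.
have /andP[_ /le_trans] := payoff_a a k; apply; rewrite lerD2r.
suff: a k <= 1 - a i by rewrite -(ler_pM2l M1); move: M0; lra.
have := sum_weight a; rewrite (bigD1 i)//= (bigD1 k)//=.
have : 0 <= \sum_(j < m.+1 | (j != i) && (j != k)) a j.
  by apply: sumr_ge0 => j _; exact: weight_ge0.
by lra.
Qed.

End PerturbedPayoffs.

(** * Pure strategies *)

Lemma payoff_flow_norm {R : realType} {m : nat} (u : 'I_m.+1 -> action m -> R)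
    (lam B : R) (a b : simplex R m) x : 0 <= lam -> lam <= 1 ->
  (forall j x, `|u j x| <= B) ->
  `|(1 - lam) * payoff u b x + lam * payoff u a x| <= B.
Proof.
move=> lam0 lam1 uB; rewrite (le_trans (ler_normD _ _))//.
rewrite !normrM (ger0_norm lam0) ger0_norm ?subr_ge0//.
rewrite [leRHS](_ : _ = (1 - lam) * B + lam * B); last by ring.
by rewrite lerD// ler_wpM2l ?subr_ge0// payoff_norm.
Qed.

(** Only the second term of the flow depends on [a], and linearly; the slopes are the discounted
    payoffs of the models along the path. This is the source of [vs_affine]. *)
Lemma discounted_affine {R : realType} {m : nat} (u : 'I_m.+1 -> action m -> R)
    (lam delta : R) a as_ xs : 0 <= delta -> delta < 1 ->
  discounted u lam delta a as_ xs =
    (1 - lam) * dsum delta (fun k => payoff u (as_ k) (xs k)) +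
    lam * \sum_j a j * dsum delta (fun k => u j (xs k)).
Proof.
move=> d0 d1; have [B uB] := payoff_bounded u.
have pB k : `|payoff u (as_ k) (xs k)| <= B by exact: payoff_norm.
have qB k : `|payoff u a (xs k)| <= B by exact: payoff_norm.
transitivity (dsum delta (fun k => (1 - lam) * payoff u (as_ k) (xs k) +
    lam * payoff u a (xs k))) => //.
rewrite (@dsumD _ _ d0 d1 (`|1 - lam| * B) (`|lam| * B)); last 2 first.
- by move=> k; rewrite normrM ler_wpM2l.
- by move=> k; rewrite normrM ler_wpM2l.
rewrite (dsumZ d0 d1 _ pB) (dsumZ d0 d1 _ qB) /payoff.
rewrite (@dsum_sum _ _ d0 d1 _ B (fun j k => a j * u j (xs k))); last first.
  move=> j k; rewrite normrM -[leRHS]mul1r ler_pM//.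
  by rewrite ger0_norm ?weight_ge0 ?weight_le1.
congr (_ + _ * _); apply: eq_bigr => j _.
by rewrite (@dsumZ _ _ d0 d1 B).
Qed.

Section PureEquilibrium.
Context {R : realType} {m : nat} (u : 'I_m.+1 -> action m -> R) (lam delta : R)
  (phi : simplex R m -> simplex R m) (z : simplex R m -> action m).
Hypotheses (lam_gt0 : 0 < lam) (lam_lt1 : lam < 1)
  (delta_gt0 : 0 < delta) (delta_lt1 : delta < 1)
  (mpe : pure_MPE u lam delta phi z).
Implicit Types (a b : simplex R m).

Let C b a := pure_value u lam delta phi z b a.

Lemma pure_value_recl b a : C b a =
  (1 - lam) * payoff u b (z b) + lam * payoff u a (z b) + delta * C (phi b) a.
Proof.
have [B uB] := payoff_bounded u.
rewrite /C /pure_value /discounted -/(dsum _ _) (@dsum_recl _ _ _ delta_lt1 B)//=.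
- by congr (_ + _ * dsum _ _); apply/funext => k; rewrite -iterSr.
- exact: ltW.
- by move=> k; apply: payoff_flow_norm => //; exact: ltW.
Qed.

Let act_weight b x : R := (x == z b)%:R.

Let sum_act_weight b (f : action m -> R) : \sum_x act_weight b x * f x = f (z b).
Proof.
rewrite (bigD1 (z b))//= /act_weight eqxx mul1r big1 ?addr0// => x /negbTE ->.
by rewrite mul0r.
Qed.

(** [vs_le] is the equilibrium condition for the deviation to [phi b], and [vs_deviation] the one
    for [b], with the first date split off. *)
Lemma pure_value_system :
  value_system u lam delta act_weight (fun a => C (phi a) a) (fun b a => C (phi b) a).
Proof.
split => //.
- by move=> b; have := sum_act_weight b (fun=> 1); under eq_bigr do rewrite mulr1.
- move=> b x xb; rewrite /act_weight; case: eqP => // xz.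
  by move: xb; rewrite xz (mpe b).1.
- have [B uB] := payoff_bounded u.
  exists (fun b => (1 - lam) * dsum delta
    (fun k => payoff u (iter k phi (phi b)) (z (iter k phi (phi b))))).
  exists (fun b j => lam * dsum delta (fun k => u j (z (iter k phi (phi b))))).
  exists (lam * (B / (1 - delta))); split.
    move=> b j; rewrite normrM ger0_norm ?(ltW lam_gt0)// ler_wpM2l ?(ltW lam_gt0)//.
    by apply: dsum_bound => //; exact: ltW.
  move=> b a; rewrite /C /pure_value discounted_affine ?ltW//; congr (_ + _).
  by rewrite mulr_sumr; apply: eq_bigr => j _; rewrite mulrCA.
- by move=> b a; exact: (mpe a).2.
- move=> b a; rewrite sum_act_weight -(zstar_best (mpe b).1) -pure_value_recl.
  exact: (mpe a).2.
Qed.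

(** The continuation from [phi (phi a)] is itself a possible deviation at [a], so it is worth at
    most [C (phi a) a]; its discounted value is absorbed on the left. *)
Lemma pure_value_step a : (1 - delta) * C (phi a) a <= (1 - lam) * best u (phi a) +
  lam * \sum_x act_weight (phi a) x * payoff u a x.
Proof.
rewrite sum_act_weight -(zstar_best (mpe (phi a)).1).
have := pure_value_recl (phi a) a.
have := ler_wpM2l (ltW delta_gt0) ((mpe a).2 (phi (phi a))); rewrite -!/(C _ _).
by lra.
Qed.

Lemma pure_path_cvg (e0 gap : R) alpha0 :
  (forall x, implementable u x -> #|argmax (fun j => u j x)| = 1%N) ->
  0 < e0 -> e0 <= 1 -> 0 < gap ->
  (forall a i, dist1 a (vertex R i) < e0 ->
     forall x, x != Some i -> payoff u a x + gap <= best u a) ->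
  exists i, coords (iter t phi alpha0) @[t --> \oo] --> coords (vertex R i).
Proof.
move=> uniq e00 e01 gap0 gapP.
apply: (path_cvg lam_gt0 lam_lt1 delta_gt0 delta_lt1 pure_value_system _
  (@Some_inj _) e00 e01 gap0 gapP) => [a|t]; last exact: pure_value_step.
exact: stationary_vertex pure_value_system a uniq.
Qed.

(** On a deterministic path the exit probability is 0 or 1, so it suffices that an exit by [T] makes
    the bound at least 1. *)
Lemma pure_exit_bound (M rho : R) T t : (2 <= m.+1)%N -> 1 / (m.+1%:R - 1) < M ->
  lambda_c m.+1 M < lam -> 0 < rho ->
  rho < Num.min (d0_param m.+1 M / 2) (1 / 2) ->
  payoff_dist u (base_payoff M) <= rho ->
  (1 <= t <= T)%N -> z (iter t phi (barycenter R m)) != act_c ->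
  1 <= 2 * rho / ((1 - delta) * b_param m.+1 M lam * delta ^+ T.-1).
Proof.
move=> n2 MM lamc rho0 rhom ud /andP[t1 tT] xt.
have b0 := b_param_gt0 n2 MM lamc.
have d1 : 0 < 1 - delta by rewrite subr_gt0.
have dge0 := ltW delta_gt0.
rewrite ler_pdivlMr ?mul1r; last by rewrite mulr_gt0 ?exprn_gt0// mulr_gt0.
set al0 := barycenter R m.
have [B uB] := payoff_bounded u.
have lo : - rho <= (1 - delta) * C (phi al0) al0.
  exact: le_trans (best_ge ud al0) (best_le_value pure_value_system al0).
(* [C (phi al0) al0] starts at date 1, hence the index [k.+1]: an exit at date [t] is discounted by
   [delta ^+ t.-1]. *)
pose ind k : R := (z (iter k.+1 phi al0) != act_c)%:R.
have indB k : `|ind k| <= 1 by rewrite /ind; case: (_ != _); rewrite ?normr1 ?normr0.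
have hi : C (phi al0) al0 <= rho / (1 - delta) - b_param m.+1 M lam * dsum delta ind.
  rewrite -(dsum_cst dge0 delta_lt1) -mulNr -(dsumZ dge0 delta_lt1 _ indB).
  rewrite -(@dsumD _ _ dge0 delta_lt1 `|rho| `|b_param m.+1 M lam|)//; last first.
    by move=> k; rewrite normrM normrN ler_piMr.
  apply: (@ler_dsum _ _ dge0 delta_lt1 B (`|rho| + `|b_param m.+1 M lam|)) => k.
  - by apply: payoff_flow_norm => //; exact: ltW.
  - by rewrite (le_trans (ler_normD _ _))// lerD// normrM normrN ler_piMr.
  - by rewrite mulNr /ind iterSr; exact: flow_barycenter_le.
have ind_ge : delta ^+ T.-1 <= dsum delta ind.
  apply: le_trans (@dsum_ge_term _ _ dge0 delta_lt1 1 _ t.-1 indB _); last first.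
    by move=> k; rewrite /ind ler0n.
  rewrite /ind prednK// xt mulr1 ler_wiXn2l// ?(ltW delta_lt1)//.
  by rewrite -!subn1 leq_sub2r.
have := ler_wpM2l (ltW d1) hi; rewrite mulrBr mulrCA divff ?gt_eqF// mulr1.
have : (1 - delta) * b_param m.+1 M lam * delta ^+ T.-1 <=
    (1 - delta) * b_param m.+1 M lam * dsum delta ind.
  by rewrite ler_wpM2l// mulr_ge0 ?ltW.
by rewrite -!mulrA; lra.
Qed.

End PureEquilibrium.

(** * Kernels and expected rewards *)

Section GraphKernel.
Context d1 d2 d3 (Om : measurableType d1) (S : measurableType d2)
  (Y : measurableType d3) (R : realType).
Variables (K : R.-pker S ~> Y) (A : Om -> S).

(** The law of (A w, y) with y drawn from [K (A w)]. The [unit] factor is the shape required to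
    compose with [P] viewed as a kernel from [unit]. *)
Definition graph_kernel (mA : measurable_fun [set: Om] A) (xw : unit * Om) :
    {measure set (S * Y) -> \bar R} :=
  measure_function_pushforward__canonical__measure_function_Measure
    (K (A xw.2)) (pair1_measurable (A xw.2)).

Hypothesis mA : measurable_fun [set: Om] A.

Let measurable_graph_kernel D : measurable D ->
  measurable_fun [set: unit * Om] (fun xw => graph_kernel mA xw D : \bar R).
Proof.
move=> mD; rewrite (_ : (fun _ => _) = (fun a => K a (xsection D a)) \o (A \o snd)).
  apply: measurableT_comp; last exact: measurableT_comp.
  by apply: measurable_fun_xsection_finite_kernel; rewrite inE.
by apply/funext => xw /=; rewrite xsectionE.
Qed.

HB.instance Definition _ :=
  isKernel.Build _ _ _ _ R (graph_kernel mA) measurable_graph_kernel.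

Let graph_kernel_setT xw : graph_kernel mA xw [set: S * Y] = 1%E.
Proof. exact: prob_kernel. Qed.

HB.instance Definition _ :=
  Kernel_isProbability.Build _ _ _ _ R (graph_kernel mA) graph_kernel_setT.

End GraphKernel.

Section Disintegration.
Local Open Scope ereal_scope.
Context d1 d2 d3 (Om : measurableType d1) (S : measurableType d2)
  (Y : measurableType d3) (R : realType).
Variables (P : probability Om R) (K : R.-pker S ~> Y) (A : Om -> S) (Z : Om -> Y).
Hypotheses (mA : measurable_fun [set: Om] A) (mZ : measurable_fun [set: Om] Z).
Hypothesis law : forall D B, measurable D -> measurable B ->
  P (A @^-1` D `&` Z @^-1` B) = \int[P]_(w in A @^-1` D) K (A w) B.

Let cst_kernel := kprobability (@measurable_cst _ _ unit _ [set: unit]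
  (P : pprobability Om R)).

Let mAZ : measurable_fun [set: Om] (fun w => (A w, Z w)).
Proof. exact: measurable_fun_pair. Qed.

(** Two finite measures agreeing on rectangles, a generating family stable under intersection; [law]
    is precisely this agreement. *)
Let joint_law D : measurable D ->
  pushforward P (fun w => (A w, Z w)) D =
  kcomp cst_kernel (graph_kernel K mA) tt D.
Proof.
apply: (measure_unique [set A1 `*` A2 | A1 in measurable & A2 in measurable]
  (fun=> setT)).
- exact: measurable_prod_measurableType.
- move=> _ _ [A1 mA1 [A2 mA2 <-]] [B1 mB1 [B2 mB2 <-]].
  exists (A1 `&` B1); first exact: measurableI.
  by exists (A2 `&` B2); [exact: measurableI|rewrite setXI].
- by move=> _; exists setT => //; exists setT => //; rewrite setXTT.
- by rewrite bigcup_const//; exists 0%N.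
- move=> _ [D1 mD1 [B mB <-]]; rewrite /pushforward/= /kcomp/=.
  transitivity (P (A @^-1` D1 `&` Z @^-1` B)).
    by congr (P _); apply/seteqP; split.
  rewrite law// integral_mkcond; apply: eq_integral => w _.
  rewrite /graph_kernel /pushforward/= patchE; case: ifPn => wD.
    by congr (K _ _); apply/seteqP; split=> [y By|y []//]; split => //; rewrite inE in wD.
  rewrite (_ : _ @^-1` _ = set0) ?measure0//; apply/seteqP; split => // y [/= Dw _].
  by move/negP: wD; apply; rewrite inE.
- by move=> k; rewrite /= /pushforward preimage_setT probability_setT ltry.
Qed.

Lemma integral_disintegration f : (forall z, 0 <= f z) ->
  measurable_fun [set: S * Y] f ->
  \int[P]_w f (A w, Z w) = \int[P]_w \int[K (A w)]_y f (A w, y).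
Proof.
move=> f0 mf.
transitivity (\int[pushforward P (fun w => (A w, Z w))]_z f z).
  by rewrite ge0_integral_pushforward// preimage_setT.
rewrite (eq_measure_integral (kcomp cst_kernel (graph_kernel K mA) tt)); last first.
  by move=> D mD _; exact: joint_law.
rewrite (@integral_kcomp _ _ _ _ _ _ _ cst_kernel (graph_kernel K mA) tt)//=.
apply: eq_integral => w _; rewrite /graph_kernel /= ge0_integral_pushforward//=.
Qed.

End Disintegration.

(** * Measurability in the worldview and the action *)

Section SimplexMeasurability.
Context {R : realType} {m : nat}.

Lemma measurable_weight j : measurable_fun [set: simplex R m] (fun a => a j).
Proof.
apply: (measurability _ (RGenOInfty.measurableE R)) => // _ [_ [c ->] <-].
rewrite setTI; apply: sub_sigma_algebra.
exists [set v : 'rV[R]_m.+1 | c < v ord0 j]; last first.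
  by apply/seteqP; split => a /=; rewrite in_itv/= andbT.
apply: (@open_comp _ _ (fun v : 'rV[R]_m.+1 => v ord0 j) [set x | c < x]).
  by move=> v _; exact: coord_continuous.
exact: open_gt.
Qed.

Lemma measurable_fun_action d (T : measurableType d) (f : action m -> T) :
  measurable_fun [set: action m] f.
Proof. by []. Qed.

Lemma measurable_set1_simplex (b : simplex R m) : measurable [set b].
Proof.
rewrite (_ : [set b] = \bigcap_(j in [set: 'I_m.+1])
    ((fun a : simplex R m => a j) @^-1` [set b j])).
  apply: fin_bigcap_measurable => // j _.
  by rewrite -[X in measurable X]setTI; exact: measurable_weight.
apply/seteqP; split => [a -> //|a ab /=].
by apply: simplex_eqP => j; exact: ab.
Qed.

(** Actions are finite and discrete: splitting by the value of [g w] reduces to the sections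
    [r ^~ x]. *)
Lemma measurable_fun_simplex_action d (T : measurableType d)
    (f : T -> simplex R m) (g : T -> action m) (r : simplex R m -> action m -> R) :
  measurable_fun [set: T] f -> measurable_fun [set: T] g ->
  (forall x, measurable_fun [set: simplex R m] (r ^~ x)) ->
  measurable_fun [set: T] (fun w => r (f w) (g w)).
Proof.
move=> mf mg mr.
rewrite (_ : (fun w => _) = (fun w => \sum_x (g w == x)%:R * r (f w) x)); last first.
  apply/funext => w; rewrite (bigD1 (g w))//= eqxx mul1r big1 ?addr0// => x.
  by rewrite eq_sym => /negbTE ->; rewrite mul0r.
apply: measurable_sum => x; apply: measurable_funM.
  exact: (measurableT_comp (@measurable_fun_action _ _ (fun y => (y == x)%:R : R)) mg).
exact: (measurableT_comp (mr x) mf).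
Qed.

Lemma measurable_payoff (u : 'I_m.+1 -> action m -> R) x :
  measurable_fun [set: simplex R m] (fun a => payoff u a x).
Proof.
apply: measurable_sum => j; apply: measurable_funM; first exact: measurable_weight.
exact: measurable_cst.
Qed.

Lemma measurable_tau_le d (T : measurableType d) (X : nat -> T -> action m) N :
  (forall t, measurable_fun [set: T] (X t)) ->
  measurable [set w | tau (X ^~ w) <= (N%:R : R)%:E]%E.
Proof.
move=> mX; rewrite (_ : [set _ | _] =
    \bigcup_(t in [set t | (1 <= t <= N)%N]) X t @^-1` [set~ act_c]).
  apply: bigcup_measurable => t _; rewrite -[X in measurable X]setTI.
  exact: mX.
apply/seteqP; split => w /=.
  by move=> /tau_leP[t tN xt]; exists t => //; exact/eqP.
by move=> [t tN xt]; apply/tau_leP; exists t => //; exact/eqP.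
Qed.

End SimplexMeasurability.

Section Process.
Local Open Scope ereal_scope.
Context {R : realType} {m : nat}
  {Pi : R.-pker simplex R m ~> (action m * simplex R m)%type}
  {b : simplex R m} {d : measure_display} {Omega : measurableType d}
  {P : probability Omega R} {A : nat -> Omega -> simplex R m}
  {X : nat -> Omega -> action m}.
Hypothesis path : path_process Pi b P A X.

Let mA t : measurable_fun [set: Omega] (A t).
Proof. by have [] := path. Qed.

Let mX t : measurable_fun [set: Omega] (X t).
Proof. by have [] := path. Qed.

Lemma process_integral t (f : simplex R m * (action m * simplex R m) -> \bar R) :
  (forall z, 0 <= f z) -> measurable_fun setT f ->
  \int[P]_w f (A t w, (X t w, A t.+1 w)) =
  \int[P]_w \int[Pi (A t w)]_y f (A t w, y).
Proof.
move=> f0 mf; apply: (@integral_disintegration _ _ _ _ _ _ _ P Pi (A t)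
  (fun w => (X t w, A t.+1 w))) => //; first exact: measurable_fun_pair.
move=> D B mD mB; have [_ _ _ law] := path.
apply: law => //; apply: sub_sigma_algebra; left.
by exists t, D.
Qed.

Lemma process_start (f : simplex R m -> \bar R) : measurable_fun setT f ->
  (forall a, 0 <= f a) -> \int[P]_w f (A 0%N w) = f b.
Proof.
move=> mf f0; have [_ _ start _] := path.
have mb : measurable [set w | A 0%N w = b].
  by have := mA 0%N measurableT (measurable_set1_simplex b); rewrite setTI.
transitivity (\int[P]_w (cst (f b) w)); last first.
  rewrite integral_cst// -[LHS]muleC -[RHS]mul1e; congr (_ * _).
  exact: probability_setT.
apply: ae_eq_integral => //; first exact: measurableT_comp.
exists (~` [set w | A 0%N w = b]); split.
- exact: measurableC.
- by rewrite [LHS]probability_setC// start subee//.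
- by move=> w /= h Aw; apply: h => _; rewrite Aw.
Qed.

End Process.

(** * Expected discounted rewards computed from the kernel *)

Section ExpectedReward.
Local Open Scope ereal_scope.
Context {R : realType} {m : nat}
  (Pi : R.-pker simplex R m ~> (action m * simplex R m)%type) (delta B : R)
  (r : simplex R m -> action m -> R).
Hypotheses (delta_ge0 : (0 <= delta)%R) (delta_lt1 : (delta < 1)%R)
  (r_ge0 : forall a x, (0 <= r a x)%R) (r_le : forall a x, (r a x <= B)%R)
  (mr : forall x, measurable_fun setT (r ^~ x)).

(** Refers to [Pi] alone and to no process, which makes the values independent of the realization.
    Rewards are nonnegative here, so sums and integrals can be exchanged freely. *)
Fixpoint expected_reward k (b : simplex R m) : \bar R :=
  if k is k'.+1 then \int[Pi b]_y expected_reward k' y.2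
  else \int[Pi b]_y (r b y.1)%:E.

Lemma expected_reward_ge0 k b : 0 <= expected_reward k b.
Proof.
by elim: k b => [|k IH] b /=; apply: integral_ge0 => y _; rewrite ?lee_fin.
Qed.

Let mreward : measurable_fun [set: simplex R m * (action m * simplex R m)]
  (fun z => (r z.1 z.2.1)%:E).
Proof.
apply/measurable_EFinP; apply: measurable_fun_simplex_action => //.
by apply: measurableT_comp => //.
Qed.

Lemma measurable_expected_reward k : measurable_fun setT (expected_reward k).
Proof.
elim: k => [|k IH] /=.
  apply: (measurable_fun_integral_finite_kernel
    (fun z : _ * (action m * simplex R m) => (r z.1 z.2.1)%:E)) => // z.
  by rewrite lee_fin.
apply: (measurable_fun_integral_finite_kernel
  (fun z : simplex R m * (action m * simplex R m) => expected_reward k z.2.2)).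
- by move=> z; exact: expected_reward_ge0.
- apply: measurableT_comp => //; exact: measurableT_comp.
Qed.

Lemma expected_reward_le k b : expected_reward k b <= B%:E.
Proof.
have le_cst a (f : action m * simplex R m -> \bar R) :
    measurable_fun setT f -> (forall y, 0 <= f y) -> (forall y, f y <= B%:E) ->
    \int[Pi a]_y f y <= B%:E.
  move=> mf f0 fB; apply: (@le_trans _ _ (\int[Pi a]_y (cst B%:E y))).
    by apply: ge0_le_integral => // y _; exact: le_trans (fB y).
  by rewrite integral_cst// prob_kernel mule1.
elim: k b => [|k IH] b /=; apply: le_cst => [|y|y].
- exact/measurable_EFinP/measurable_fun_simplex_action.
- by rewrite lee_fin.
- by rewrite lee_fin.
- by apply: measurableT_comp => //; exact: measurable_expected_reward.
- exact: expected_reward_ge0.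
- exact: IH.
Qed.

Lemma expected_reward_process b d (Omega : measurableType d)
    (P : probability Omega R) (A : nat -> Omega -> simplex R m)
    (X : nat -> Omega -> action m) k : path_process Pi b P A X ->
  \int[P]_w (r (A k w) (X k w))%:E = expected_reward k b.
Proof.
move=> path.
(* Induction on [t]: conditioning on [A t] trades the last date of the process for one more
   application of the kernel, until only the known start is left. *)
have shift j t : \int[P]_w expected_reward j (A t w) = expected_reward (j + t) b.
  elim: t j => [|t IH] j.
    rewrite addn0 (process_start path)//; first exact: measurable_expected_reward.
    exact: expected_reward_ge0.
  rewrite addnS -addSn -IH /=.
  apply: (process_integral path t (f := fun z => expected_reward j z.2.2)).
    by move=> z; exact: expected_reward_ge0.
  apply: measurableT_comp; first exact: measurable_expected_reward.
  exact: measurableT_comp.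
rewrite -[k in RHS]add0n -shift /=.
apply: (process_integral path k (f := fun z => (r z.1 z.2.1)%:E)) => //.
by move=> z; rewrite lee_fin.
Qed.

Definition discounted_reward b : \bar R :=
  \sum_(k <oo) (delta ^+ k)%:E * expected_reward k b.

Let discounted_term_ge0 k b : 0 <= (delta ^+ k)%:E * expected_reward k b.
Proof. by rewrite mule_ge0 ?expected_reward_ge0// lee_fin exprn_ge0. Qed.

Lemma discounted_reward_ge0 b : 0 <= discounted_reward b.
Proof. by apply: nneseries_ge0 => k _ _; exact: discounted_term_ge0. Qed.

Lemma measurable_discounted_reward : measurable_fun setT discounted_reward.
Proof.
apply: ge0_emeasurable_sum => [k b _ _|k _]; first exact: discounted_term_ge0.
by apply: measurable_funeM; exact: measurable_expected_reward.
Qed.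

Lemma EFin_dsum (y : nat -> R) C : (forall k, `|y k| <= C)%R ->
  (dsum delta y)%:E = \sum_(k <oo) (delta ^+ k)%:E * (y k)%:E.
Proof.
move=> yC; rewrite -EFin_lim; last exact: dsum_cvg yC.
by apply: congr_lim; apply/funext => n /=; rewrite /series/= -sumEFin.
Qed.

Lemma discounted_reward_le b : discounted_reward b <= ((B / (1 - delta))%R)%:E.
Proof.
rewrite -(dsum_cst delta_ge0 delta_lt1) (@EFin_dsum _ `|B|%R)//.
apply: lee_nneseries => k _; first by move=> _; exact: discounted_term_ge0.
by rewrite lee_wpmul2l ?expected_reward_le// lee_fin exprn_ge0.
Qed.

Lemma discounted_reward_recl b : discounted_reward b =
  \int[Pi b]_y ((r b y.1)%:E + delta%:E * discounted_reward y.2).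
Proof.
have mE k : measurable_fun setT
    (fun y : action m * simplex R m => expected_reward k y.2).
  by apply: measurableT_comp => //; exact: measurable_expected_reward.
rewrite ge0_integralD//; last 4 first.
- by move=> y _; rewrite lee_fin.
- exact/measurable_EFinP/measurable_fun_simplex_action.
- by move=> y _; rewrite mule_ge0// discounted_reward_ge0.
- apply: measurable_funeM; apply: measurableT_comp => //.
  exact: measurable_discounted_reward.
rewrite ge0_integralZl//; last 2 first.
- by apply: measurableT_comp => //; exact: measurable_discounted_reward.
- by move=> y _; exact: discounted_reward_ge0.
rewrite /discounted_reward (integral_nneseries _ measurableT); last 2 first.
- by move=> k; exact: measurable_funeM.
- by move=> k y _; exact: discounted_term_ge0.
rewrite nneseries_recl//.
rewrite expr0 mul1e; congr (_ + _).
rewrite -nneseriesZl; last first.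
  by move=> k _; apply: integral_ge0 => y _; exact: discounted_term_ge0.
rewrite -nneseries_addn//.
apply: eq_eseriesr => k _; rewrite addn1 /=.
rewrite ge0_integralZl ?lee_fin ?exprn_ge0//; last by move=> y _; exact: expected_reward_ge0.
by rewrite muleA -EFinM exprS.
Qed.

Lemma discounted_reward_process b d (Omega : measurableType d)
    (P : probability Omega R) (A : nat -> Omega -> simplex R m)
    (X : nat -> Omega -> action m) : path_process Pi b P A X ->
  \int[P]_w (dsum delta (fun k => r (A k w) (X k w)))%:E = discounted_reward b.
Proof.
move=> path; have [mA mX _ _] := path.
have mr' k : measurable_fun setT (fun w => (r (A k w) (X k w))%:E).
  exact/measurable_EFinP/measurable_fun_simplex_action.
under eq_integral => w _.
  rewrite (@EFin_dsum _ B); last by move=> k; rewrite ger0_norm.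
  over.
rewrite (integral_nneseries _ measurableT); last 2 first.
- by move=> k; exact: measurable_funeM.
- by move=> k w _; rewrite mule_ge0// lee_fin// exprn_ge0.
apply: eq_eseriesr => k _.
rewrite ge0_integralZl ?lee_fin ?exprn_ge0//; last by move=> w _; rewrite lee_fin.
by rewrite (expected_reward_process k path).
Qed.

End ExpectedReward.

(** * Value functions *)

Section BoundedIntegral.
Context d (T : measurableType d) (R : realType) (mu : {measure set T -> \bar R}).
Hypothesis mu1 : mu [set: T] = 1%E.
Implicit Types (f g : T -> R).

Definition bounded_measurable f :=
  measurable_fun [set: T] f /\ exists C, forall x, `|f x| <= C.

Lemma bounded_measurable_cst c : bounded_measurable (fun=> c).
Proof. by split; [exact: measurable_cst|exists `|c|]. Qed.

Lemma bounded_measurableD f g : bounded_measurable f -> bounded_measurable g ->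
  bounded_measurable (fun x => f x + g x).
Proof.
move=> [mf [C fC]] [mg [D gD]]; split; first exact: measurable_funD.
by exists (C + D) => x; rewrite (le_trans (ler_normD _ _))// lerD.
Qed.

Lemma bounded_measurableM f g : bounded_measurable f -> bounded_measurable g ->
  bounded_measurable (fun x => f x * g x).
Proof.
move=> [mf [C fC]] [mg [D gD]]; split; first exact: measurable_funM.
by exists (C * D) => x; rewrite normrM ler_pM.
Qed.

Lemma bounded_measurableZ c f : bounded_measurable f ->
  bounded_measurable (fun x => c * f x).
Proof. by apply: bounded_measurableM; exact: bounded_measurable_cst. Qed.

Lemma bounded_measurable_sum (I : Type) (s : seq I) (f : I -> T -> R) :
  (forall i, bounded_measurable (f i)) ->
  bounded_measurable (fun x => \sum_(i <- s) f i x).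
Proof.
move=> bf; elim: s => [|i s IH].
  by under eq_fun do rewrite big_nil; exact: bounded_measurable_cst.
by under eq_fun do rewrite big_cons; exact: bounded_measurableD.
Qed.

Lemma bounded_measurable_integrable f :
  bounded_measurable f -> mu.-integrable [set: T] (EFin \o f).
Proof.
move=> [mf [C fC]]; apply: measurable_bounded_integrable => //.
  by rewrite mu1 ltry.
by exists C; split; [exact: num_real|move=> x Cx y _; exact: le_trans (ltW Cx)].
Qed.

Lemma EFin_Rintegral f : bounded_measurable f ->
  (\int[mu]_x f x)%:E = (\int[mu]_x (f x)%:E)%E.
Proof.
move=> /bounded_measurable_integrable fi; rewrite fineK//.
exact: integrable_fin_num.
Qed.

Lemma Rintegral_prob_cst c : \int[mu]_x c = c.
Proof. by rewrite Rintegral_cst// mu1 mulr1. Qed.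

Lemma bounded_RintegralD f g : bounded_measurable f -> bounded_measurable g ->
  \int[mu]_x (f x + g x) = \int[mu]_x f x + \int[mu]_x g x.
Proof.
by move=> bf bg; rewrite RintegralD//; exact: bounded_measurable_integrable.
Qed.

Lemma bounded_RintegralZ c f : bounded_measurable f ->
  \int[mu]_x (c * f x) = c * \int[mu]_x f x.
Proof. by move=> bf; rewrite RintegralZl//; exact: bounded_measurable_integrable. Qed.

Lemma bounded_Rintegral_sum (I : Type) (s : seq I) (f : I -> T -> R) :
  (forall i, bounded_measurable (f i)) ->
  \int[mu]_x (\sum_(i <- s) f i x) = \sum_(i <- s) \int[mu]_x f i x.
Proof.
move=> bf; elim: s => [|i s IH].
  by under eq_Rintegral do rewrite big_nil; rewrite Rintegral_prob_cst big_nil.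
under eq_Rintegral do rewrite big_cons.
by rewrite bounded_RintegralD ?IH ?big_cons//; exact: bounded_measurable_sum.
Qed.

Lemma bounded_le_Rintegral f g : bounded_measurable f -> bounded_measurable g ->
  (forall x, f x <= g x) -> \int[mu]_x f x <= \int[mu]_x g x.
Proof.
by move=> bf bg fg; apply: le_Rintegral => //; exact: bounded_measurable_integrable.
Qed.

Lemma bounded_Rintegral_norm f C : bounded_measurable f -> (forall x, `|f x| <= C) ->
  `|\int[mu]_x f x| <= C.
Proof.
move=> bf fC; rewrite ler_norml -[leLHS]Rintegral_prob_cst -[X in _ && (_ <= X)]Rintegral_prob_cst.
by apply/andP; split; apply: bounded_le_Rintegral => //; try exact: bounded_measurable_cst;
  move=> x; have := fC x; rewrite ler_norml => /andP[].
Qed.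

End BoundedIntegral.

Section ValueFunction.
Context {R : realType} {m : nat}
  (Pi : R.-pker simplex R m ~> (action m * simplex R m)%type) (delta B : R)
  (r : simplex R m -> action m -> R).
Hypotheses (delta_ge0 : 0 <= delta) (delta_lt1 : delta < 1)
  (rB : forall a x, `|r a x| <= B)
  (mr : forall x, measurable_fun setT (r ^~ x)).

Lemma bounded_measurable_dsum d (Omega : measurableType d)
    (A : nat -> Omega -> simplex R m) (X : nat -> Omega -> action m) :
  (forall t, measurable_fun setT (A t)) -> (forall t, measurable_fun setT (X t)) ->
  bounded_measurable (fun w => dsum delta (fun k => r (A k w) (X k w))).
Proof.
move=> mA mX; split; last first.
  by exists (B / (1 - delta)) => w; exact: dsum_bound.
apply: (@measurable_fun_cvg _ _ _ _ (fun n w =>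
    series (fun k => delta ^+ k * r (A k w) (X k w)) n)) => [n|w _].
  apply: measurable_sum => k; apply: measurable_funM; first exact: measurable_cst.
  exact: measurable_fun_simplex_action.
exact: (@dsum_cvg _ _ delta_ge0 delta_lt1 B).
Qed.

(** Signed rewards are reduced to nonnegative ones by adding the bound [B]; the discounted sum then
    grows by the constant [B / (1 - delta)], subtracted at the end. *)
Lemma value_function : exists V : simplex R m -> R,
  [/\ bounded_measurable V,
      forall b d (Omega : measurableType d) (P : probability Omega R) A X,
        path_process Pi b P A X ->
        \int[P]_w dsum delta (fun k => r (A k w) (X k w)) = V b &
      forall b, V b = \int[Pi b]_y (r b y.1 + delta * V y.2)].
Proof.
have B0 : 0 <= B := le_trans (normr_ge0 _) (rB (barycenter R m) act_c).
pose r' a x := r a x + B.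
have r'_ge0 a x : 0 <= r' a x.
  by have := rB a x; rewrite ler_norml /r' => /andP[]; lra.
have r'_le a x : r' a x <= B + B.
  by have := rB a x; rewrite ler_norml /r' => /andP[]; lra.
have mr' x : measurable_fun setT (r' ^~ x) by exact: measurable_funD.
have d1 : 0 < 1 - delta by rewrite subr_gt0.
pose W := discounted_reward Pi delta r'; pose c := B / (1 - delta).
have W_ge0 b : (0 <= W b)%E by exact: discounted_reward_ge0.
have W_le b : (W b <= ((B + B) / (1 - delta))%:E)%E by exact: discounted_reward_le.
have WE b : W b = (fine (W b))%:E.
  by rewrite fineK// ge0_fin_numE//; exact: le_lt_trans (W_le b) (ltry _).
have bW : bounded_measurable (fun b => fine (W b)).
  split.
    by apply: measurableT_comp => //; exact: measurable_discounted_reward.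
  exists ((B + B) / (1 - delta)) => b; rewrite ger0_norm ?fine_ge0//.
  by rewrite -lee_fin -WE.
have bV := bounded_measurableD bW (bounded_measurable_cst _ (- c)).
exists (fun b => fine (W b) - c); split => //.
- move=> b d Omega P A X path; have [mA mX _ _] := path.
  have bd := bounded_measurable_dsum mA mX.
  have P1 : (P : {measure set Omega -> \bar R}) setT = 1%E by exact: probability_setT.
  have bd' := bounded_measurableD bd (bounded_measurable_cst _ c).
  have := discounted_reward_process delta_ge0 delta_lt1 r'_ge0 r'_le mr' path.
  rewrite -/(W b) => <-.
  under [X in _ = fine X - _]eq_integral => w _.
    rewrite (@dsumD _ _ delta_ge0 delta_lt1 B `|B|)// dsum_cst//.
    over.
  rewrite -/(Rintegral _ _ _) bounded_RintegralD// ?Rintegral_prob_cst ?addrK//.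
  exact: bounded_measurable_cst.
- move=> b; have Pi1 : Pi b setT = 1%E by exact: prob_kernel.
  have mY : bounded_measurable (fun y : action m * simplex R m => fine (W y.2)).
    have [mW [C WC]] := bW; split; last by exists C => y.
    exact: (measurableT_comp mW measurable_snd).
  have br : bounded_measurable (fun y : action m * simplex R m => r b y.1).
    split; last by exists B.
    by apply: measurable_fun_simplex_action => //; exact: measurable_fst.
  have bs := bounded_measurableD br (bounded_measurableZ delta mY).
  have shift e : \int[Pi b]_y (r b y.1 + delta * fine (W y.2) + e) =
      \int[Pi b]_y (r b y.1 + delta * fine (W y.2)) + e.
    rewrite (bounded_RintegralD Pi1 bs (bounded_measurable_cst _ e)).
    by rewrite Rintegral_prob_cst.
  transitivity (\int[Pi b]_y (r b y.1 + delta * fine (W y.2) + B) - c).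
    congr (_ - _); rewrite {1}/W discounted_reward_recl//; congr fine.
    apply: eq_integral => y _; rewrite -/(W y.2) WE -EFinM -EFinD /r'.
    by rewrite addrAC.
  (* [c] is the discounted sum of the constant [B], so [B - c = - (delta * c)]. *)
  transitivity (\int[Pi b]_y (r b y.1 + delta * fine (W y.2) + - (delta * c))).
    rewrite !shift -addrA; congr (_ + _).
    by rewrite /c; field; rewrite gt_eqF.
  by apply: eq_Rintegral => y _; rewrite mulrBr addrA.
Qed.

End ValueFunction.

(** * Randomized strategies *)

Section ProcessNull.
Local Open Scope ereal_scope.
Context {R : realType} {m : nat}
  {Pi : R.-pker simplex R m ~> (action m * simplex R m)%type}
  {b : simplex R m} {d : measure_display} {Omega : measurableType d}
  {P : probability Omega R} {A : nat -> Omega -> simplex R m}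
  {X : nat -> Omega -> action m}.
Hypothesis path : path_process Pi b P A X.

(** Turns optimality on average into optimality along the path: the mean of [f] at each date is 0,
    so [f] vanishes almost surely there, and countably many null sets are merged into one. *)
Lemma process_ae_eq0 (f : simplex R m * (action m * simplex R m) -> R) :
  (forall z, (0 <= f z)%R) -> measurable_fun setT f ->
  (forall a, \int[Pi a]_y (f (a, y))%:E = 0) ->
  {ae P, forall w, forall t, f (A t w, (X t w, A t.+1 w)) = 0%R}.
Proof.
move=> f0 mf int0; apply/ae_foralln => t; have [mA mX _ _] := path.
have mF : measurable_fun setT (fun w => (f (A t w, (X t w, A t.+1 w)))%:E).
  apply/measurable_EFinP; apply: (@measurableT_comp _ _ _ _ _ _ f _
    (fun w => (A t w, (X t w, A t.+1 w)))) => //.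
  by apply: measurable_fun_pair => //; exact: measurable_fun_pair.
have : \int[P]_w `|(f (A t w, (X t w, A t.+1 w)))%:E| = 0.
  under eq_integral => w _ do rewrite gee0_abs ?lee_fin//.
  rewrite (process_integral path t (f := fun z => (f z)%:E)); last 2 first.
  - by move=> z; rewrite lee_fin.
  - exact/measurable_EFinP.
  by under eq_integral do rewrite int0; rewrite integral0.
move=> /(ae_eq_integral_abs P measurableT mF); apply: filterS => w /(_ I).
by case.
Qed.

End ProcessNull.

Section RandomizedEquilibrium.
Context {R : realType} {m : nat} (u : 'I_m.+1 -> action m -> R) (lam delta : R)
  (Pi : R.-pker simplex R m ~> (action m * simplex R m)%type).
Hypotheses (lam_gt0 : 0 < lam) (lam_lt1 : lam < 1)
  (delta_gt0 : 0 < delta) (delta_lt1 : delta < 1).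
Implicit Types (a b : simplex R m).

Let delta_ge0 : 0 <= delta := ltW delta_gt0.

Let Pi1 b : Pi b setT = 1%E.
Proof. exact: prob_kernel. Qed.

Definition action_prob b x : R := fine (Pi b (fst @^-1` [set x])).

Let measurable_fst_eq x : measurable (fst @^-1` [set x] : set (action m * simplex R m)).
Proof. by rewrite -[X in measurable X]setTI; exact: measurable_fst. Qed.

Lemma action_prob_ge0 b x : 0 <= action_prob b x.
Proof. by rewrite fine_ge0. Qed.

Lemma measurable_action_prob x : measurable_fun setT (action_prob ^~ x).
Proof.
apply: measurableT_comp => //; exact: measurable_kernel.
Qed.

Let bounded_measurable_fst (f : action m -> R) :
  bounded_measurable (fun y : action m * simplex R m => f y.1).
Proof.
split; last first.
  exists (\sum_x `|f x|) => y; rewrite (bigD1 y.1)//= lerDl.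
  by rewrite sumr_ge0.
apply: (@measurableT_comp _ _ _ _ _ _ f _ fst); last exact: measurable_fst.
exact: measurable_fun_action.
Qed.

Let bounded_measurable_snd (f : simplex R m -> R) : bounded_measurable f ->
  bounded_measurable (fun y : action m * simplex R m => f y.2).
Proof.
by move=> [mf [C fC]]; split; [exact: (measurableT_comp mf measurable_snd)|exists C].
Qed.

Lemma Rintegral_fst b (f : action m -> R) :
  \int[Pi b]_y f y.1 = \sum_x action_prob b x * f x.
Proof.
transitivity (\int[Pi b]_y (\sum_x f x * \1_(fst @^-1` [set x]) y)).
  apply: eq_Rintegral => y _; rewrite (bigD1 y.1)//= indicE mem_set// mulr1.
  rewrite big1 ?addr0// => x xy; rewrite indicE memNset ?mulr0//= => yx.
  by rewrite yx eqxx in xy.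
have bind x : bounded_measurable (\1_(fst @^-1` [set x]) : action m * simplex R m -> R).
  split; first exact: measurable_indic.
  by exists 1 => y; rewrite indicE; case: (_ \in _); rewrite ?normr1 ?normr0.
rewrite (bounded_Rintegral_sum (Pi1 b)); last by move=> x; exact: bounded_measurableZ.
apply: eq_bigr => x _; rewrite (bounded_RintegralZ (Pi1 b))// mulrC; congr (_ * _).
by rewrite /Rintegral integral_indic// setIT.
Qed.

Lemma sum_action_prob b : \sum_x action_prob b x = 1.
Proof.
have := Rintegral_fst b (fun=> 1); rewrite (Rintegral_prob_cst (Pi1 b)) => ->.
by apply: eq_bigr => x _; rewrite mulr1.
Qed.

(** The second clause ranges over all realizations: it is applied both to those supplied by the
    equilibrium and to the process given in the theorem. *)
Definition is_value (r : simplex R m -> action m -> R) (V : simplex R m -> R) :=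
  [/\ bounded_measurable V,
      forall b d (Omega : measurableType d) (P : probability Omega R) A X,
        path_process Pi b P A X ->
        \int[P]_w dsum delta (fun k => r (A k w) (X k w)) = V b &
      forall b, V b = \sum_x action_prob b x * r b x + delta * \int[Pi b]_y V y.2].

Lemma is_value_ex B (r : simplex R m -> action m -> R) : (forall a x, `|r a x| <= B) ->
  (forall x, measurable_fun setT (r ^~ x)) -> exists V, is_value r V.
Proof.
move=> rB mr; have [V [bV procV VE]] := value_function Pi delta_ge0 delta_lt1 rB mr.
exists V; split => // b; rewrite {1}VE.
have bV2 := bounded_measurable_snd bV.
rewrite (bounded_RintegralD (Pi1 b))//; last exact: bounded_measurableZ.
by rewrite Rintegral_fst (bounded_RintegralZ (Pi1 b)).
Qed.

(** Measurability is read off the recursion solved for its last term, which divides by [delta]. *)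
Lemma is_value_next (r : simplex R m -> action m -> R) V :
  (forall x, measurable_fun setT (r ^~ x)) -> is_value r V ->
  bounded_measurable (fun b => \int[Pi b]_y V y.2).
Proof.
move=> mr [[mV [C VC]] _ VE]; split; last first.
  exists C => b; apply: (bounded_Rintegral_norm (Pi1 b)) => //.
  by apply: bounded_measurable_snd; split => //; exists C.
rewrite (_ : (fun _ => _) =
    (fun b => delta^-1 * (V b - \sum_x action_prob b x * r b x))); last first.
  by apply/funext => b; rewrite {1}VE addrAC subrr add0r mulKf ?gt_eqF.
apply: measurable_funM; first exact: measurable_cst.
apply: measurable_funB => //; apply: measurable_sum => x.
by apply: measurable_funM => //; exact: measurable_action_prob.
Qed.

Section Values.
Variables (VU : simplex R m -> R) (VJ : 'I_m.+1 -> simplex R m -> R).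
Hypotheses (VUP : is_value (payoff u) VU)
  (VJP : forall j, is_value (fun _ x => u j x) (VJ j)).

(** This is C_Pi(b; a), by [random_value_plan]. Written with finitely many functions of [b], it is
    visibly affine in [a] and measurable in both arguments. *)
Definition plan_value b a := (1 - lam) * VU b + lam * \sum_j a j * VJ j b.

(** On the diagonal this is S(a). In general it values at [a] the plan chosen at [b] after the
    current action, and serves as the support [H b]. *)
Definition next_value b a := \int[Pi b]_y plan_value y.2 a.

Let bounded_plan a : bounded_measurable (plan_value ^~ a).
Proof.
have [bU _ _] := VUP; apply: bounded_measurableD; apply: bounded_measurableZ => //.
apply: bounded_measurable_sum => j; apply: bounded_measurableZ.
by have [] := VJP j.
Qed.

Lemma random_value_plan b a d (Omega : measurableType d) (P : probability Omega R)
    A X : path_process Pi b P A X ->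
  random_value u lam delta P A X a = (plan_value b a)%:E.
Proof.
move=> path; have [mA mX _ _] := path.
have P1 : (P : {measure set Omega -> \bar R}) setT = 1%E by exact: probability_setT.
have [B uB] := payoff_bounded u.
have pB a' x : `|payoff u a' x| <= B by exact: payoff_norm.
have bU := bounded_measurable_dsum delta_ge0 delta_lt1 pB (measurable_payoff u) mA mX.
have bJ j := bounded_measurable_dsum delta_ge0 delta_lt1 (fun (_ : simplex R m) x => uB j x)
   (fun x => measurable_cst (u j x)) mA mX.
have bS := bounded_measurable_sum (index_enum 'I_m.+1)
  (fun j => bounded_measurableZ (a j) (bJ j)).
have [_ procU _] := VUP.
rewrite /random_value unlock; under eq_integral => w _.
  rewrite /= discounted_affine//.
  over.
rewrite -(EFin_Rintegral P1); last by apply: bounded_measurableD; exact: bounded_measurableZ.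
congr EFin; rewrite (bounded_RintegralD P1); try exact: bounded_measurableZ.
rewrite !(bounded_RintegralZ P1)// (procU _ _ _ _ _ _ path) (bounded_Rintegral_sum P1).
  congr (_ + _ * _); apply: eq_bigr => j _; rewrite (bounded_RintegralZ P1)//.
  by have [_ procJ _] := VJP j; rewrite (procJ _ _ _ _ _ _ path).
by move=> j; exact: bounded_measurableZ.
Qed.

Lemma next_valueE b a : next_value b a = (1 - lam) * \int[Pi b]_y VU y.2 +
  \sum_j a j * (lam * \int[Pi b]_y VJ j y.2).
Proof.
have [/bounded_measurable_snd bU _ _] := VUP.
have bJ j : bounded_measurable (fun y : action m * simplex R m => VJ j y.2).
  by have [/bounded_measurable_snd] := VJP j.
have bS := bounded_measurable_sum (index_enum 'I_m.+1)
  (fun j => bounded_measurableZ (a j) (bJ j)).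
rewrite /next_value /plan_value (bounded_RintegralD (Pi1 b)); try exact: bounded_measurableZ.
rewrite !(bounded_RintegralZ (Pi1 b))// (bounded_Rintegral_sum (Pi1 b)); last first.
  by move=> j; exact: bounded_measurableZ.
rewrite mulr_sumr; congr (_ + _); apply: eq_bigr => j _.
by rewrite (bounded_RintegralZ (Pi1 b))// mulrCA.
Qed.

Lemma plan_value_recl b a : plan_value b a =
  \sum_x action_prob b x * ((1 - lam) * payoff u b x + lam * payoff u a x) +
  delta * next_value b a.
Proof.
rewrite next_valueE /plan_value; have [_ _ ->] := VUP.
under [X in _ + lam * X]eq_bigr => j _.
  have [_ _ ->] := VJP j.
  over.
have -> : \sum_x action_prob b x * ((1 - lam) * payoff u b x + lam * payoff u a x) =
    (1 - lam) * (\sum_x action_prob b x * payoff u b x) +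
    lam * (\sum_x action_prob b x * payoff u a x).
  rewrite !mulr_sumr -big_split/=; apply: eq_bigr => x _; ring.
have -> : \sum_j a j * (\sum_x action_prob b x * u j x + delta * \int[Pi b]_y VJ j y.2) =
    \sum_j a j * (\sum_x action_prob b x * u j x) +
    delta * \sum_j a j * \int[Pi b]_y VJ j y.2.
  rewrite mulr_sumr -big_split/=; apply: eq_bigr => j _; ring.
have -> : \sum_j a j * (lam * \int[Pi b]_y VJ j y.2) =
    lam * \sum_j a j * \int[Pi b]_y VJ j y.2.
  by rewrite mulr_sumr; apply: eq_bigr => j _; rewrite mulrCA.
have -> : \sum_x action_prob b x * payoff u a x =
    \sum_j a j * \sum_x action_prob b x * u j x.
  rewrite /payoff; under eq_bigr do rewrite mulr_sumr.
  rewrite exchange_big/=; apply: eq_bigr => j _; rewrite mulr_sumr.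
  by apply: eq_bigr => x _; rewrite mulrCA.
ring.
Qed.

Hypothesis mpe : randomized_MPE u lam delta Pi.

(** The optimal actions already carry mass 1, and the event of playing [x] is disjoint from them. *)
Lemma action_prob_supp b x : x \notin zstar u b -> action_prob b x = 0.
Proof.
move=> xb; case: (mpe) => d' [Om [P [A [X [_ eqm]]]]].
have [z1 _] := eqm b; rewrite /action_prob (_ : Pi b _ = 0%E)//.
apply/eqP; rewrite eq_le measure_ge0 andbT.
have mZ : measurable (fst @^-1` [set` zstar u b] : set (action m * simplex R m)).
  by rewrite -[X in measurable X]setTI; exact: measurable_fst.
have mZx := measurableU _ _ mZ (measurable_fst_eq x).
have : (Pi b (fst @^-1` [set` zstar u b] `|` fst @^-1` [set x]) <= 1)%E.
  by rewrite -(Pi1 b); apply: le_measure; rewrite ?inE//; exact: subsetT.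
rewrite measureU//; last first.
  apply/seteqP; split => // y [/= yz yx].
  by move: yz; rewrite /mkset yx (negbTE xb).
move=> le1; rewrite -(@leeD2lE _ 1%E)// adde0.
by rewrite -[X in (X + _)%E]z1.
Qed.

Lemma action_prob_best b : \sum_x action_prob b x * payoff u b x = best u b.
Proof.
rewrite -[RHS]mul1r -(sum_action_prob b) mulr_suml; apply: eq_bigr => x _.
have [xb|xb] := boolP (x \in zstar u b); first by rewrite zstar_best.
by rewrite action_prob_supp// !mul0r.
Qed.

Lemma plan_value_le g a : plan_value g a <= next_value a a.
Proof.
case: (mpe) => d' [Om [P [A [X [proc eqm]]]]].
have [_ /(_ g)] := eqm a; rewrite (random_value_plan _ (proc g)).
rewrite (eq_integral (fun b => (plan_value b a)%:E)); last first.
  by move=> b _; rewrite (random_value_plan _ (proc b)).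
have bp := bounded_plan a; have [mp _] := bp.
rewrite integral_pushforward//.
- rewrite preimage_setT => h.
  by rewrite -lee_fin /next_value (EFin_Rintegral (Pi1 a) (bounded_measurable_snd bp)).
- exact/measurable_EFinP.
- rewrite preimage_setT.
  exact: (bounded_measurable_integrable (Pi1 a) (bounded_measurable_snd bp)).
Qed.

Lemma plan_value_split b a : plan_value b a = (1 - lam) * best u b +
  lam * (\sum_x action_prob b x * payoff u a x) + delta * next_value b a.
Proof.
rewrite plan_value_recl -action_prob_best !mulr_sumr -big_split/=.
by congr (_ + _); apply: eq_bigr => x _; ring.
Qed.

(** [next_value b a] averages plan values at [a], none of which exceeds S(a) by equilibrium; this
    gives [vs_le]. [vs_deviation] is [plan_value_le] with the first date split off. *)
Lemma random_value_system :
  value_system u lam delta action_prob (fun a => next_value a a) next_value.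
Proof.
split => //.
- exact: action_prob_ge0.
- exact: sum_action_prob.
- exact: action_prob_supp.
- have bJ j : exists C, forall b, `|VJ j b| <= C by have [[_]] := VJP j.
  have [CJ CJP] := choice bJ.
  exists (fun b => (1 - lam) * \int[Pi b]_y VU y.2).
  exists (fun b j => lam * \int[Pi b]_y VJ j y.2).
  exists (lam * \sum_j `|CJ j|); split => [b j|b a]; last exact: next_valueE.
  rewrite normrM ger0_norm ?(ltW lam_gt0)// ler_wpM2l ?(ltW lam_gt0)//.
  apply: (@le_trans _ _ `|CJ j|); last by rewrite (bigD1 j)//= lerDl sumr_ge0.
  apply: (bounded_Rintegral_norm (Pi1 b)) => [|y].
    by apply: bounded_measurable_snd; have [] := VJP j.
  exact: le_trans (CJP j _) (ler_norm _).
- move=> b a; rewrite /next_value -[leRHS](Rintegral_prob_cst (Pi1 b)).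
  apply: (bounded_le_Rintegral (Pi1 b)) => [||y]; last exact: plan_value_le.
    exact: bounded_measurable_snd (bounded_plan a).
  exact: bounded_measurable_cst.
- by move=> b a; rewrite -plan_value_split; exact: plan_value_le.
Qed.

(** The equality says that [g] is an optimal choice at [a]. The continuation after [g] is worth at
    most S(a), and its [delta] multiple moves to the left. *)
Lemma plan_value_step g a : plan_value g a = next_value a a ->
  (1 - delta) * next_value a a <= (1 - lam) * best u g +
    lam * \sum_x action_prob g x * payoff u a x.
Proof.
have := ler_wpM2l delta_ge0 (vs_le random_value_system g a).
rewrite plan_value_split; lra.
Qed.

Section Paths.
Context {b : simplex R m} {d : measure_display} {Omega : measurableType d}
  {P : probability Omega R} {A : nat -> Omega -> simplex R m}
  {X : nat -> Omega -> action m}.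
Hypothesis path : path_process Pi b P A X.

Let measurable_best : measurable_fun setT (best u).
Proof.
rewrite (_ : best u = fun b => \sum_x action_prob b x * payoff u b x); last first.
  by apply/funext => a; rewrite action_prob_best.
apply: measurable_sum => x; apply: measurable_funM; first exact: measurable_action_prob.
exact: measurable_payoff.
Qed.

Let measurable_next : measurable_fun setT (fun a => next_value a a).
Proof.
rewrite (_ : (fun _ => _) = (fun a => (1 - lam) * \int[Pi a]_y VU y.2 +
  \sum_j a j * (lam * \int[Pi a]_y VJ j y.2))); last first.
  by apply/funext => a; rewrite next_valueE.
have [mU _] := is_value_next (measurable_payoff u) VUP.
apply: measurable_funD; first by apply: measurable_funM => //; exact: measurable_cst.
apply: measurable_sum => j; apply: measurable_funM; first exact: measurable_weight.
apply: measurable_funM; first exact: measurable_cst.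
by have [] := is_value_next (fun x => measurable_cst (u j x)) (VJP j).
Qed.

Lemma ae_action_optimal : {ae P, forall w, forall t, X t w \in zstar u (A t w)}.
Proof.
have : {ae P, forall w, forall t, best u (A t w) - payoff u (A t w) (X t w) = 0}.
  apply: (process_ae_eq0 path (f := fun z => best u z.1 - payoff u z.1 z.2.1)).
  - by move=> z; rewrite subr_ge0 payoff_le_best.
  - apply: measurable_funB; first exact: (measurableT_comp measurable_best measurable_fst).
    apply: measurable_fun_simplex_action; [exact: measurable_fst| |exact: measurable_payoff].
    exact: (measurableT_comp measurable_fst measurable_snd).
  - move=> a /=; have bf := bounded_measurable_fst (fun x => best u a - payoff u a x).
    rewrite -(EFin_Rintegral (Pi1 a) bf) (Rintegral_fst a (fun x => best u a - payoff u a x)).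
    rewrite (eq_bigr (fun x => action_prob a x * best u a - action_prob a x * payoff u a x)).
      by rewrite sumrB -mulr_suml sum_action_prob mul1r action_prob_best subrr.
    by move=> x _; rewrite mulrBr.
apply: filterS => w h t; rewrite zstarE eq_sym -subr_eq0; exact/eqP.
Qed.

(** S(a) is the average under [Pi a] of plan values that never exceed it, so the gap is nonnegative
    with mean 0. *)
Lemma ae_plan_optimal : {ae P, forall w, forall t,
  plan_value (A t.+1 w) (A t w) = next_value (A t w) (A t w)}.
Proof.
have : {ae P, forall w, forall t,
    next_value (A t w) (A t w) - plan_value (A t.+1 w) (A t w) = 0}.
  apply: (process_ae_eq0 path
    (f := fun z => next_value z.1 z.1 - plan_value z.2.2 z.1)).
  - by move=> z; rewrite subr_ge0 plan_value_le.
  - have m22 : measurable_fun setT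
        (fun z : simplex R m * (action m * simplex R m) => z.2.2).
      exact: (measurableT_comp measurable_snd measurable_snd).
    apply: measurable_funB; first exact: (measurableT_comp measurable_next measurable_fst).
    have [[mU _] _ _] := VUP.
    apply: measurable_funD.
      by apply: measurable_funM; [exact: measurable_cst|exact: (measurableT_comp mU m22)].
    apply: measurable_funM; first exact: measurable_cst.
    apply: measurable_sum => j; apply: measurable_funM.
      exact: (measurableT_comp (measurable_weight j) measurable_fst).
    by have [[mJ _] _ _] := VJP j; exact: (measurableT_comp mJ m22).
  - move=> a /=; have bp := bounded_measurable_snd (bounded_plan a).
    have bp' := bounded_measurableZ (-1) bp.
    have bc := bounded_measurable_cst (action m * simplex R m)%type (next_value a a).
    under eq_integral => y _ do rewrite -mulN1r.
    rewrite -(EFin_Rintegral (Pi1 a) (bounded_measurableD bc bp')).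
    rewrite (bounded_RintegralD (Pi1 a) bc bp') (Rintegral_prob_cst (Pi1 a)).
    by rewrite (bounded_RintegralZ (Pi1 a) _ bp) mulN1r subrr.
by apply: filterS => w h t; apply/esym/eqP; rewrite -subr_eq0; exact/eqP.
Qed.

Lemma ae_path_cvg (e0 gap : R) :
  (forall x, implementable u x -> #|argmax (fun j => u j x)| = 1%N) ->
  0 < e0 -> e0 <= 1 -> 0 < gap ->
  (forall a i, dist1 a (vertex R i) < e0 ->
     forall x, x != Some i -> payoff u a x + gap <= best u a) ->
  {ae P, forall w, exists i, coords (A t w) @[t --> \oo] --> coords (vertex R i)}.
Proof.
move=> uniq e00 e01 gap0 gapP; apply: filterS ae_plan_optimal => w opt.
apply: (path_cvg lam_gt0 lam_lt1 delta_gt0 delta_lt1 random_value_system _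
  (@Some_inj _) e00 e01 gap0 gapP) => [a|t].
  exact: stationary_vertex random_value_system a uniq.
exact: plan_value_step.
Qed.

End Paths.

Lemma random_exit_bound (M rho : R) T d (Omega : measurableType d)
    (P : probability Omega R) A X :
  (2 <= m.+1)%N -> 1 / (m.+1%:R - 1) < M -> lambda_c m.+1 M < lam -> 0 < rho ->
  rho < Num.min (d0_param m.+1 M / 2) (1 / 2) ->
  payoff_dist u (base_payoff M) <= rho -> (1 <= T)%N ->
  path_process Pi (barycenter R m) P A X ->
  (P [set w | tau (X ^~ w) <= (T%:R : R)%:E] <=
    (2 * rho / ((1 - delta) * b_param m.+1 M lam * delta ^+ T.-1))%:E)%E.
Proof.
move=> n2 MM lamc rho0 rhom ud T1 path.
have b0 := b_param_gt0 n2 MM lamc.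
have d1 : 0 < 1 - delta by rewrite subr_gt0.
set al0 := barycenter R m in path *; set bp := b_param _ _ _ in b0 *.
have [B uB] := payoff_bounded u.
have lo : - rho <= (1 - delta) * next_value al0 al0.
  exact: le_trans (best_ge ud al0) (best_le_value random_value_system al0).
(* A reward of 1 at each date without [act_c]; its value [Vc] is the expected discounted frequency
   of such dates, date 0 included. *)
pose rc (_ : simplex R m) (x : action m) : R := (x != act_c)%:R.
have rc1 a x : `|rc a x| <= 1.
  by rewrite /rc; case: (_ != _); rewrite ?normr1 ?normr0.
have mrc x : measurable_fun setT (rc ^~ x) by exact: measurable_cst.
have [Vc VcP] := is_value_ex rc1 mrc; have [bVc procVc VcE] := VcP.
pose rf a x := (1 - lam) * payoff u a x + lam * payoff u al0 x.
have rfB a x : `|rf a x| <= B by apply: payoff_flow_norm => //; exact: ltW.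
have mrf x : measurable_fun setT (rf ^~ x).
  apply: measurable_funD; last exact: measurable_cst.
  by apply: measurable_funM; [exact: measurable_cst|exact: measurable_payoff].
(* The given process starts at the barycenter, so for a general [g] the comparison is made on the
   realization supplied by the equilibrium. *)
have plan_hi g : plan_value g al0 <= rho / (1 - delta) + - bp * Vc g.
  case: (mpe) => d' [Om [Q [A' [X' [proc _]]]]].
  have [mA mX _ _] := proc g.
  have Q1 : (Q g : {measure set Om -> \bar R}) setT = 1%E by exact: probability_setT.
  have bf := bounded_measurable_dsum delta_ge0 delta_lt1 rfB mrf mA mX.
  have bc := bounded_measurable_dsum delta_ge0 delta_lt1 rc1 mrc mA mX.
  have -> : plan_value g al0 =
      \int[Q g]_w dsum delta (fun k => rf (A' k w) (X' k w)).
    apply: EFin_inj; rewrite -(random_value_plan al0 (proc g)).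
    by rewrite (EFin_Rintegral Q1 bf) /random_value unlock.
  rewrite -(procVc _ _ _ _ _ _ (proc g)) -(bounded_RintegralZ Q1 _ bc).
  rewrite -[rho / _](Rintegral_prob_cst Q1).
  have bs := bounded_measurable_cst Om (rho / (1 - delta)).
  have bz := bounded_measurableZ (- bp) bc.
  rewrite -(bounded_RintegralD Q1 bs bz).
  apply: (bounded_le_Rintegral Q1 bf (bounded_measurableD bs bz)) => w.
  rewrite -(dsum_cst delta_ge0 delta_lt1) -(dsumZ delta_ge0 delta_lt1 (B := 1))//.
  rewrite -(@dsumD _ _ delta_ge0 delta_lt1 `|rho| `|bp|)//; last first.
    by move=> k; rewrite normrM normrN ler_piMr.
  apply: (@ler_dsum _ _ delta_ge0 delta_lt1 B (`|rho| + `|bp|)) => // k.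
    by rewrite (le_trans (ler_normD _ _))// lerD// normrM normrN ler_piMr.
  rewrite mulNr; exact: flow_barycenter_le.
have bV2 := bounded_measurable_snd bVc.
have hi : next_value al0 al0 <= rho / (1 - delta) - bp * \int[Pi al0]_y Vc y.2.
  rewrite -mulNr -(bounded_RintegralZ (Pi1 al0) _ bV2) -[rho / _](Rintegral_prob_cst (Pi1 al0)).
  have bs := bounded_measurable_cst (action m * simplex R m)%type (rho / (1 - delta)).
  have bz := bounded_measurableZ (- bp) bV2.
  rewrite -(bounded_RintegralD (Pi1 al0) bs bz).
  apply: (bounded_le_Rintegral (Pi1 al0) _ (bounded_measurableD bs bz)) => [|y].
    exact: bounded_measurable_snd (bounded_plan al0).
  exact: plan_hi.
(* Date 0 contributes nothing at the barycenter. The factor [delta] gained here lowers the exponent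
   from [T] to [T.-1] in the final bound. *)
have VcN : Vc al0 = delta * \int[Pi al0]_y Vc y.2.
  rewrite VcE big1 ?add0r// => x _; rewrite /rc.
  have [->|xc] := eqVneq x act_c; first by rewrite mulr0.
  rewrite action_prob_supp ?mul0r//; apply: contra xc => xz; apply/eqP.
  exact: (zstar_barycenter rhom ud).
have [mA mX _ _] := path.
have P1 : (P : {measure set Omega -> \bar R}) setT = 1%E by exact: probability_setT.
set E := [set w | _].
have mE : measurable E by exact: measurable_tau_le.
have PE : P E = (fine (P E))%:E by rewrite fineK// fin_num_measure.
have bE : bounded_measurable (\1_E : Omega -> R).
  split; first exact: measurable_indic.
  by exists 1 => w; rewrite indicE; case: (_ \in _); rewrite ?normr1 ?normr0.
(* A Markov-type inequality: on the event of an exit by [T] the discounted frequency is at least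
   [delta ^+ T]. *)
have exitP : delta ^+ T * fine (P E) <= Vc al0.
  rewrite -(procVc _ _ _ _ _ _ path).
  have -> : delta ^+ T * fine (P E) = \int[P]_w (delta ^+ T * \1_E w).
    by rewrite (bounded_RintegralZ P1 _ bE) /Rintegral integral_indic// setIT.
  apply: (bounded_le_Rintegral P1 (bounded_measurableZ _ bE)
    (bounded_measurable_dsum delta_ge0 delta_lt1 rc1 mrc mA mX)) => w.
  rewrite indicE; case: (boolP (w \in E)) => wE; last first.
    by rewrite mulr0; apply: (@dsum_ge0 _ _ delta_ge0 delta_lt1 1) => // k; rewrite ler0n.
  rewrite mulr1; move: wE; rewrite inE => /tau_leP[t /andP[_ tT] xt].
  have rc0 k : 0 <= rc (A k w) (X k w) by rewrite ler0n.
  apply: le_trans (@dsum_ge_term _ _ delta_ge0 delta_lt1 1 _ t _ rc0) => //.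
  by rewrite /rc xt mulr1 ler_wiXn2l// ltW.
rewrite PE lee_fin ler_pdivlMr; last by rewrite !mulr_gt0 ?exprn_gt0.
move: exitP; rewrite VcN -(prednK T1) exprS -mulrA ler_pM2l// => exitP.
have h1 := ler_wpM2l (ltW d1) hi; rewrite mulrBr mulrCA divff ?gt_eqF// mulr1 in h1.
have : (1 - delta) * bp * (delta ^+ T.-1 * fine (P E)) <=
    (1 - delta) * bp * \int[Pi al0]_y Vc y.2.
  by rewrite ler_wpM2l// mulr_ge0 ?ltW.
by move: h1 lo; lra.
Qed.

End Values.

End RandomizedEquilibrium.

(** * From convergence to exit, and the four conclusions *)

Lemma converge_exit {R : realType} {m : nat} (M rho : R) (alpha : nat -> simplex R m)
    (x : nat -> action m) (i : 'I_m.+1) : 0 < 2 * (1 - 2 * rho) / (1 + M) ->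
  (forall t, x t = act_c ->
    2 * (1 - 2 * rho) / (1 + M) <= dist1_set (alpha t) (@pure_worldviews R m)) ->
  coords (alpha t) @[t --> \oo] --> coords (vertex R i) ->
  (tau x < +oo :> \bar R)%E.
Proof.
set e := (X in 0 < X) => e0 far cv.
have [N _ HN] := cv _ (nbhs_coords_dist1 (vertex R i) e0).
(* [N.+1] is positive, as [tau] ignores date 0. Playing [act_c] there would keep the worldview [e]
   away from every vertex, although it is already closer than [e] to [vertex R i]. *)
apply: (@tau_lt_pinfty _ _ x N.+1) => //; apply/eqP => /far.
have := HN N.+1 (leqnSn N) (alpha N.+1) erefl.
rewrite ltNge => /negP near /le_trans le_e; apply/near/le_e.
apply: inf_lbound; last by exists (vertex R i) => //; exists i.
by exists 0 => _ [p _ <-]; exact: dist1_ge0.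
Qed.

Lemma rho_boundP {R : realType} (n : nat) (M lam delta eta rho : R) T :
  0 < (1 - delta) * b_param n M lam * delta ^+ T.-1 ->
  rho < rho_bound n M lam delta T eta ->
  rho < Num.min (d0_param n M / 2) (1 / 2) /\
  2 * rho / ((1 - delta) * b_param n M lam * delta ^+ T.-1) < eta.
Proof.
move=> pos; rewrite !lt_min => /and3P[-> -> h]; split => //.
by rewrite ltr_pdivrMr//; move: h; rewrite ltr_pdivlMr// -!mulrA mulrC.
Qed.

Theorem corollary9p6 (R : realType) (m : nat) (n_ge2 : (2 <= m.+1)%N)
    (M lam delta : R) (M_gt : 1 / (m.+1%:R - 1) < M)
    (lam_bounds : lambda_c m.+1 M < lam /\ lam < 1)
    (delta_bounds : 0 < delta /\ delta < 1) :
  let b := b_param m.+1 M lam in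
  let d0 := d0_param m.+1 M in
  let alpha0 := barycenter R m in
  [/\ 0 < b,
      0 < d0,
      (* (1), (2), (3) *)
      forall (rho : R) (u : 'I_m.+1 -> action m -> R),
        0 < rho -> rho < Order.min (d0 / 2) (1 / 2) ->
        payoff_dist u (base_payoff M) <= rho ->
        let bound T := Order.min 1 (2 * rho / ((1 - delta) * b * delta ^+ T.-1)) in
        let far a := [/\ max_weight a <= (M + 2 * rho) / (1 + M),
                         2 * (1 - 2 * rho) / (1 + M) <=
                           dist1_set a (@pure_worldviews R m) &
                         0 < 2 * (1 - 2 * rho) / (1 + M)] in
        let unique_best := forall x, implementable u x ->
                             #|argmax (fun j => u j x)| = 1%N in
        let converges (alpha : nat -> simplex R m) :=
          exists2 p, @pure_worldviews R m p &
            (fun t => coords (alpha t)) @ \oo --> coords p in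
        (forall phi z, pure_MPE u lam delta phi z ->
          let alpha t := iter t phi alpha0 in
          let x t := z (alpha t) in
          [/\ forall T, (1 <= T)%N ->
                (path_prob x [set y | tau y <= (T%:R : R)%:E] <= (bound T)%:E)%E,
              forall t, x t = act_c -> far (alpha t) &
              unique_best -> converges alpha /\ (tau x < +oo :> \bar R)%E]) /\
        (forall Pi, randomized_MPE u lam delta Pi ->
          forall (d : measure_display) (Omega : measurableType d)
            (P : probability Omega R) (alpha : nat -> Omega -> simplex R m)
            (x : nat -> Omega -> action m),
          path_process Pi alpha0 P alpha x ->
          [/\ forall T, (1 <= T)%N ->
                (P [set w | tau (x ^~ w) <= (T%:R : R)%:E] <= (bound T)%:E)%E,
              {ae P, forall w, forall t, x t w = act_c -> far (alpha t w)} &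
              unique_best ->
                {ae P, forall w, converges (alpha ^~ w)} /\
                {ae P, forall w, (tau (x ^~ w) < +oo :> \bar R)%E}]) &
      (* (4) *)
      forall (T : nat) (eta : R), (1 <= T)%N -> 0 < eta -> eta < 1 ->
        0 < rho_bound m.+1 M lam delta T eta /\
        forall (rho : R) (u : 'I_m.+1 -> action m -> R),
          0 < rho -> rho < rho_bound m.+1 M lam delta T eta ->
          payoff_dist u (base_payoff M) <= rho ->
          let stays := [set y : nat -> action m |
                         forall t, (1 <= t <= T)%N -> y t = act_c] in
          (forall phi z, pure_MPE u lam delta phi z ->
            let x t := z (iter t phi alpha0) in
            path_prob x stays =
              path_prob x [set y | (T%:R : R)%:E < tau y]%E :> \bar R /\
            ((1 - eta)%:E < path_prob x [set y | (T%:R : R)%:E < tau y])%E) /\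
          (forall Pi, randomized_MPE u lam delta Pi ->
            forall (d : measure_display) (Omega : measurableType d)
              (P : probability Omega R) (alpha : nat -> Omega -> simplex R m)
              (x : nat -> Omega -> action m),
            path_process Pi alpha0 P alpha x ->
            P [set w | stays (x ^~ w)] =
              P [set w | (T%:R : R)%:E < tau (x ^~ w)]%E /\
            ((1 - eta)%:E < P [set w | (T%:R : R)%:E < tau (x ^~ w)])%E)].
Proof.
case: lam_bounds => lamc lam1; case: delta_bounds => delta0 delta1 b d0 alpha0.
have b0 : 0 < b by exact: b_param_gt0.
have d00 : 0 < d0 by exact: d0_gt0.
have lam0 : 0 < lam by exact: lt_trans (lambda_c_gt0 n_ge2 M_gt) lamc.
have delta1' : 0 < 1 - delta by rewrite subr_gt0.
have pos T : 0 < (1 - delta) * b * delta ^+ T.-1 by rewrite !mulr_gt0 ?exprn_gt0.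
have pureP rho u phi z T : 0 < rho -> rho < Num.min (d0 / 2) (1 / 2) ->
    payoff_dist u (base_payoff M) <= rho -> pure_MPE u lam delta phi z ->
    let x t := z (iter t phi alpha0) in
    (tau x <= (T%:R : R)%:E)%E ->
    1 <= 2 * rho / ((1 - delta) * b * delta ^+ T.-1).
  move=> rho0 rhom ud mpe x /tau_leP[t tT xt].
  exact: (pure_exit_bound lam0 lam1 delta0 delta1 mpe n_ge2 M_gt lamc rho0 rhom ud tT xt).
have randP rho u Pi T d (Omega : measurableType d) (P : probability Omega R) alpha x :
    0 < rho -> rho < Num.min (d0 / 2) (1 / 2) ->
    payoff_dist u (base_payoff M) <= rho -> randomized_MPE u lam delta Pi ->
    (1 <= T)%N -> path_process Pi alpha0 P alpha x ->
    (P [set w | tau (x ^~ w) <= (T%:R : R)%:E] <=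
      (2 * rho / ((1 - delta) * b * delta ^+ T.-1))%:E)%E.
  move=> rho0 rhom ud mpe T1 path; have [B uB] := payoff_bounded u.
  have [VU VUP] := is_value_ex Pi delta0 delta1
    (fun a x => payoff_norm a (uB ^~ x)) (measurable_payoff u).
  have /choice[VJ VJP] j := is_value_ex Pi delta0 delta1
    (fun (_ : simplex R m) x => uB j x) (fun x => measurable_cst (u j x)).
  exact: (random_exit_bound lam0 lam1 delta0 delta1 VUP VJP mpe n_ge2 M_gt lamc
    rho0 rhom ud T1 path).
split => //.
- move=> rho u rho0 rhom ud bound far unique_best converges.
  have farP a : act_c \in zstar u a -> far a by exact: safe_far.
  have [e0 [gap [e00 e01 gap0 gapP]]] := gap_near_vertex n_ge2 M_gt rho0 rhom ud.
  split=> [phi z mpe alpha x|Pi mpe d Omega P alpha x path].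
  + have xfar t : x t = act_c -> far (alpha t).
      by move=> xc; apply: farP; rewrite -xc; exact: (mpe _).1.
    split => //.
      move=> T T1; rewrite /path_prob lee_fin indicE.
      case: (boolP (x \in _)) => [|_].
        rewrite inE /= => /(pureP _ _ _ _ _ rho0 rhom ud mpe) h.
        by rewrite /bound le_min lexx h.
      by rewrite /bound le_min ler01 divr_ge0 ?(ltW (pos T))// mulr_ge0// ltW.
    move=> uniq.
    have [i cv] := pure_path_cvg lam0 lam1 delta0 delta1 mpe alpha0 uniq e00 e01 gap0 gapP.
    split; first by exists (vertex R i) => //; exists i.
    apply: (converge_exit (M := M) (rho := rho) _ _ cv); last first.
      by move=> t /xfar[].
    exact: (safe_distance_gt0 n_ge2 M_gt rhom).
  + have [B uB] := payoff_bounded u.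
    have [VU VUP] := is_value_ex Pi delta0 delta1
      (fun a x => payoff_norm a (uB ^~ x)) (measurable_payoff u).
    have /choice[VJ VJP] j := is_value_ex Pi delta0 delta1
      (fun (_ : simplex R m) x => uB j x) (fun x => measurable_cst (u j x)).
    have xfar : {ae P, forall w, forall t, x t w = act_c -> far (alpha t w)}.
      have := ae_action_optimal mpe path; apply: filterS => w opt t xc.
      by apply: farP; rewrite -xc.
    split => //.
      move=> T T1; have [_ mx _ _] := path.
      rewrite /bound EFin_min le_min probability_le1 /=; last exact: measurable_tau_le.
      exact: (randP _ _ _ _ _ _ _ _ _ rho0 rhom ud mpe T1 path).
    move=> uniq.
    have cv := ae_path_cvg lam0 lam1 delta0 delta1 VUP VJP mpe path uniq e00 e01 gap0 gapP.
    split.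
      by move: cv; apply: filterS => w [i cvi]; exists (vertex R i) => //; exists i.
    move: cv xfar; apply: filterS2 => w [i cvi] wfar.
    apply: (converge_exit (M := M) (rho := rho) _ _ cvi) => [|t /wfar[]//].
    exact: (safe_distance_gt0 n_ge2 M_gt rhom).
- move=> T eta T1 eta0 eta1; split.
    rewrite /rho_bound !lt_min (divr_gt0 d00)// (divr_gt0 ltr01)//=.
    by rewrite divr_gt0// !mulr_gt0// exprn_gt0.
  move=> rho u rho0 /(rho_boundP (pos T))[rhom rhoT] ud stays.
  split=> [phi z mpe x|Pi mpe d Omega P alpha x path].
  + have staysE : stays = [set y | (T%:R : R)%:E < tau y]%E.
      by apply/funext => y; rewrite /stays /mkset tau_gtE.
    rewrite -staysE; split => //; rewrite staysE /path_prob lte_fin indicE.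
    (* A deterministic exit by [T] would give 1 <= bound < [eta] < 1. *)
    case: (boolP (x \in _)) => [_|]; first by rewrite ltrBlDr ltrDl.
    rewrite notin_setE /= => /negP; rewrite -leNgt.
    move=> /(pureP _ _ _ _ _ rho0 rhom ud mpe) h.
    by have := lt_trans (le_lt_trans h rhoT) eta1; rewrite ltxx.
  + have staysE : [set w | stays (x ^~ w)] = [set w | (T%:R : R)%:E < tau (x ^~ w)]%E.
      by apply/funext => w; rewrite /stays /mkset tau_gtE.
    split; first by rewrite staysE.
    have [_ mx _ _] := path; have mtau := measurable_tau_le (R := R) T mx.
    rewrite (_ : [set w | _] = ~` [set w | tau (x ^~ w) <= (T%:R : R)%:E]%E); last first.
      by apply/seteqP; split => w /=; rewrite ltNge => /negP.
    have := randP _ _ _ _ _ _ _ _ _ rho0 rhom ud mpe T1 path.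
    set E := [set w | _] in mtau *.
    have PE : P E = (fine (P E))%:E by rewrite fineK// fin_num_measure.
    rewrite [P (~` E)]probability_setC// PE lee_fin -EFinB lte_fin.
    by move: rhoT; rewrite -/b; lra.
Qed.
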